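(* For every locally constant, compactly supported (complex-valued) function $f$ on the Lie algebra $\mathfrak{g}=\mathfrak{sl}_2(F)$, $$\int_{\mathfrak{t}_1} |b| \int_{A_1 \backslash G} f \left(g^{-1} \begin{pmatrix} 0 & b \\ b & 0 \end{pmatrix} g \right)\, dg\, db = \int_F \tilde{f} \begin{pmatrix} 0 & 2n \\ 0 & 0 \end{pmatrix} \, dn .$$
   Context: $F$ is a $p$-adic field of characteristic zero and residue characteristic greater than two, with ring of integers $\mathcal{O}$, and normalized absolute value $|\cdot|$. The additive Haar measure on $F$ gives $\mathcal{O}$ measure one. $G=SL_2(F)$, $K=SL_2(\mathcal{O})$. $\mathfrak{h}=\{\mathrm{diag}(h,-h):h\in F\}$, with measure $dX=dh$; $\mathfrak{h}^\perp=\left\{\begin{pmatrix}0&b\\c&0\end{pmatrix}: b,c\in F\right\}$ is its orthogonal complement in $\mathfrak{g}$ for the Killing form, with measure $db\,dc$. $\hat f(Y)=\int_{\mathfrak{g}} f(X)\psi(\langle X,Y\rangle)\,dX$ is the Fourier transform, where $\langle\cdot,\cdot\rangle$ is the Killing form, $\psi$ is a fixed nontrivial additive character of $F$, and the Haar measure on $\mathfrak{g}$ is normalized so that $\int_{\mathfrak{h}}\hat f(X)\,dX=\int_{\mathfrak{h}^\perp}f(X)\,dX$ for all locally constant compactly supported $f$, with the measure $dX=dh$ on $\mathfrak{h}$ and the measure $dX=db\,dc$ on $\mathfrak{h}^\perp$. $\tilde f(X)=\int_K\hat f(k^{-1}Xk)\,dk$, where $dk$ gives $K$ measure one. $\mathfrak{t}_1=\left\{\begin{pmatrix}0&b\\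 b&0\end{pmatrix}:b\in F\right\}$ with measure $db$, and $A_1=\left\{\begin{pmatrix}a&b\\ b&a\end{pmatrix}:a^2-b^2=1\right\}$ is its centralizer in $G$, an $F$-split maximal torus. Haar measures on $G$ and $A_1$ are normalized so that $K$ and $A_1\cap K$ have measure one, and $A_1\backslash G$ carries the quotient measure. *)

(* Defs.v *)
From HB Require Import structures.
From mathcomp Require Import all_boot all_order all_algebra.
From mathcomp Require Import all_classical all_reals all_analysis.
From mathcomp Require Export complex.
From mathcomp Require Import ring generic_quotient.

Set Implicit Arguments.
Unset Strict Implicit.
Unset Printing Implicit Defensive.

Import Order.TTheory GRing.Theory Num.Theory.
Import numFieldNormedType.Exports.

Local Open Scope classical_set_scope.
Local Open Scope complex_scope.
Local Open Scope ring_scope.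

(** [res] restricts to a surjective ring morphism from the valuation ring
    [v x <= 1] onto [k], with kernel the maximal ideal [v x < 1]; its values
    outside the valuation ring are irrelevant. *)
Definition is_residue_map (R : realType) (F : fieldType) (v : F -> R)
    (k : finFieldType) (res : F -> k) : Prop :=
  [/\ forall x y, v x <= 1 -> v y <= 1 -> res (x + y) = res x + res y,
      forall x y, v x <= 1 -> v y <= 1 -> res (x * y) = res x * res y,
      res 1 = 1,
      forall x, v x <= 1 -> (res x = 0 <-> v x < 1) &
      forall a, exists2 x, v x <= 1 & res x = a].

(** A finite extension of some Q_p, presented as a field of characteristic
    zero that is complete for a discrete ultrametric absolute value with finite
    residue field of cardinality q; the absolute value is normalized by giving
    a uniformizer the value q^-1. *)
HB.mixin Record isPadicField (R : realType) F of GRing.Field F := {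
  pabs : F -> R;
  pabs_ge0 : forall x, 0 <= pabs x;
  pabs_eq0 : forall x, pabs x = 0 <-> x = 0;
  pabsM : forall x y, pabs (x * y) = pabs x * pabs y;
  pabs_ultra : forall x y, pabs (x + y) <= Num.max (pabs x) (pabs y);
  padic_pchar0 : [pchar F] =i pred0;
  pabs_normalized : exists (k : finFieldType) (res : F -> k) (w : F),
    [/\ is_residue_map pabs res, 0 < pabs w < 1,
        forall x, pabs x < 1 -> pabs x <= pabs w &
        pabs w = #|k|%:R^-1];
  padic_complete : forall u : nat -> F,
    (forall e : R, 0 < e -> exists N, forall m n, (N <= m)%N -> (N <= n)%N ->
       pabs (u m - u n) < e) ->
    exists l, forall e : R, 0 < e -> exists N, forall n, (N <= n)%N ->
       pabs (u n - l) < e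
}.

#[short(type="padicFieldType")]
HB.structure Definition PadicField (R : realType) :=
  {F of GRing.Field F & isPadicField R F}.

Section PadicTopology.
Context {R : realType} {F : padicFieldType R}.

Local Notation dist := (fun x y : F => pabs (x - y) : R).

Fact pabs1 : pabs (1 : F) = 1 :> R.
Proof.
have h : pabs (1 : F) != 0 :> R.
  by apply/eqP => /pabs_eq0/eqP; rewrite oner_eq0.
by apply: (mulfI h); rewrite -pabsM !mulr1.
Qed.

Fact pabsN (x : F) : pabs (- x) = pabs x :> R.
Proof.
suff h : pabs (-1 : F) = 1 :> R by rewrite -mulN1r pabsM h mul1r.
have : pabs (-1 : F) ^+ 2 = 1 :> R by rewrite expr2 -pabsM mulrNN mulr1 pabs1.
by move/eqP; rewrite sqrf_eq1 => /orP[/eqP//|/eqP h]; have := pabs_ge0 (-1 : F);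
   rewrite h oppr_ge0 ler10.
Qed.

Fact pdist_ge0 (x y : F) : 0 <= dist x y.
Proof. exact: pabs_ge0. Qed.

Fact pdist_eq0 (x y : F) : dist x y = 0 -> x = y.
Proof. by move/pabs_eq0/eqP; rewrite subr_eq0 => /eqP. Qed.

Fact pdistxx (x : F) : dist x x = 0.
Proof. by rewrite /= subrr; apply/pabs_eq0. Qed.

Fact pdistC (x y : F) : dist x y = dist y x.
Proof. by rewrite /= -pabsN opprB. Qed.

Fact pdist_triangle (y x z : F) : dist x z <= dist x y + dist y z.
Proof.
have /= -> : x - z = (x - y) + (y - z) by rewrite addrA subrK.
apply: (le_trans (pabs_ultra _ _)).
by rewrite ge_max lerDl lerDr !pabs_ge0.
Qed.

HB.instance Definition _ := isMetric.Build R (PadicField.sort F)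
  pdistxx pdist_eq0 pdistC pdist_triangle.
HB.instance Definition _ := isPointed.Build (PadicField.sort F) 0.

End PadicTopology.

Definition residue_char (R : realType) (F : padicFieldType R) (p : nat) :=
  exists (k : finFieldType) (res : F -> k),
    is_residue_map (@pabs R F) res /\ p \in [pchar k].

Definition pint (R : realType) (F : padicFieldType R) : set F :=
  [set x | pabs x <= 1].
Arguments pint {R} F.

Definition additive_character (R : realType) (F : padicFieldType R)
    (psi : F -> R[i]) : Prop :=
  [/\ continuous (psi : F -> R[i]^o), forall x y, psi (x + y) = psi x * psi y &
      forall x, `|psi x| = 1].

Notation borel T := (g_sigma_algebraType (@open T)).

(** As with [Rintegral], the value is only meaningful when the integral
    converges absolutely. *)
Definition cintegral d (T : measurableType d) (R : realType)
    (mu : {measure set T -> \bar R}) (D : set T) (f : T -> R[i]) : R[i] :=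
  (\int[mu]_(x in D) complex.Re (f x)) +i* (\int[mu]_(x in D) complex.Im (f x)).

(** Apart from nonvanishing, [mu] is a left Haar measure of the closed subgroup [H]
    of the group [T] with law [op]; it is carried as the Borel measure on [T]
    that gives mass zero to the complement of [H], so that integrals against
    it are taken over the domain [H].  All groups below are locally compact and
    second countable, where finiteness on compact sets implies regularity.
    Nonvanishing is always imposed through a normalization. *)
Definition is_haar (R : realType) (T : ptopologicalType) (op : T -> T -> T)
    (H : set T) (mu : {measure set (borel T) -> \bar R}) : Prop :=
  [/\ mu (~` H) = 0%E,
      forall (h : T) (A : set (borel T)), H h -> measurable A ->
        mu [set x | A (op h x)] = mu A &
      forall C : set T, compact C -> (mu C < +oo)%E].

Definition locally_constant (T : topologicalType) (U : Type) (f : T -> U) :=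
  forall x : T, \forall y \near x, f y = f x.

Definition compactly_supported (T : topologicalType) (V : zmodType)
    (f : T -> V) :=
  compact (closure [set x | f x != 0]).

Definition mx2 (A : Type) (a b c d : A) : 'M[A]_2 :=
  \matrix_(i < 2, j < 2)
    if i == 0 then if j == 0 then a else b else if j == 0 then c else d.

Definition trace0 (F : fieldType) : {pred 'M[F]_2} := fun X => \tr X == 0.

Fact trace0_zmod_closed (F : fieldType) : zmod_closed (@trace0 F).
Proof.
split=> [|X Y /eqP hX /eqP hY]; rewrite unfold_in ?mxtrace0 //.
by rewrite raddfB /= hX hY subrr.
Qed.
HB.instance Definition _ (F : fieldType) :=
  GRing.isZmodClosed.Build 'M[F]_2 (@trace0 F) (@trace0_zmod_closed F).

Section Sl2.
Context {R : realType} (F : padicFieldType R).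

Record sl2 := Sl2 { sl2_val :> 'M[F]_2; _ : sl2_val \in @trace0 F }.
HB.instance Definition _ := [isSub for sl2_val].
HB.instance Definition _ := [Choice of sl2 by <:].
HB.instance Definition _ := [SubChoice_isSubZmodule of sl2 by <:].
HB.instance Definition _ := Topological.copy sl2 (initial_topology sl2_val).
HB.instance Definition _ := isPointed.Build sl2 0.

Record SL2 := mkSL2 { SL2_val :> 'M[F]_2; _ : \det SL2_val == 1 }.
HB.instance Definition _ := [isSub for SL2_val].
HB.instance Definition _ := [Choice of SL2 by <:].
HB.instance Definition _ := Topological.copy SL2 (initial_topology SL2_val).

Implicit Types (g h : SL2) (X Y : sl2).

Fact SL2_det g : \det g = 1. Proof. exact/eqP/(valP g). Qed.

Fact SL2_unit g : (g : 'M[F]_2) \is a GRing.unit.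
Proof. by rewrite unitmxE SL2_det unitr1. Qed.

Fact SL2_one_subproof : \det (1 : 'M[F]_2) == 1.
Proof. by rewrite det1. Qed.

Fact SL2_mul_subproof g h : \det ((g : 'M[F]_2) * h) == 1.
Proof. by rewrite det_mulmx !SL2_det mulr1. Qed.

Fact SL2_inv_subproof g : \det ((g : 'M[F]_2)^-1) == 1.
Proof. by rewrite det_inv SL2_det invr1. Qed.

Definition SL2_one : SL2 := mkSL2 SL2_one_subproof.
Definition SL2_mul g h : SL2 := mkSL2 (SL2_mul_subproof g h).
Definition SL2_inv g : SL2 := mkSL2 (SL2_inv_subproof g).

Fact SL2_mulA : associative SL2_mul.
Proof. by move=> x y z; apply/val_inj; rewrite /= mulrA. Qed.
Fact SL2_mul1 : left_id SL2_one SL2_mul.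
Proof. by move=> x; apply/val_inj; rewrite /= mul1r. Qed.
Fact SL2_mulr1 : right_id SL2_one SL2_mul.
Proof. by move=> x; apply/val_inj; rewrite /= mulr1. Qed.
Fact SL2_mulV : left_inverse SL2_one SL2_inv SL2_mul.
Proof. by move=> x; apply/val_inj; rewrite /= mulVr ?SL2_unit. Qed.
Fact SL2_mulrV : right_inverse SL2_one SL2_inv SL2_mul.
Proof. by move=> x; apply/val_inj; rewrite /= mulrV ?SL2_unit. Qed.

HB.instance Definition _ := isGroup.Build SL2
  SL2_mulA SL2_mul1 SL2_mulr1 SL2_mulV SL2_mulrV.
HB.instance Definition _ := isPointed.Build SL2 1%g.

Fact adj_subproof g X : (g : 'M[F]_2)^-1 * (X : 'M[F]_2) * g \in @trace0 F.
Proof.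
rewrite unfold_in mxtrace_mulC [_ *m _]mulrA mulrV ?SL2_unit // mul1r.
exact: (valP X).
Qed.
(** [adj g X] is g^-1 X g, a right action. *)
Definition adj g X : sl2 := Sl2 (adj_subproof g X).

Fact sl2_mx_subproof (a b c : F) : mx2 a b c (- a) \in @trace0 F.
Proof.
by rewrite unfold_in /mxtrace big_ord_recl big_ord1 !mxE /= subrr.
Qed.
Definition sl2_mx (a b c : F) : sl2 := Sl2 (sl2_mx_subproof a b c).

Fact bracket_subproof X Y : (X : 'M[F]_2) * Y - (Y : 'M[F]_2) * X \in @trace0 F.
Proof. by rewrite unfold_in raddfB /= mxtrace_mulC subrr. Qed.
Definition bracket X Y : sl2 := Sl2 (bracket_subproof X Y).

(** tr (ad X o ad Y), computed in the basis [sl2_mx 1 0 0], [sl2_mx 0 1 0],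
    [sl2_mx 0 0 1], for which the coordinates of Z are Z 0 0, Z 0 1, Z 1 0. *)
Definition killing X Y : F :=
  bracket X (bracket Y (sl2_mx 1 0 0)) 0 0
  + bracket X (bracket Y (sl2_mx 0 1 0)) 0 1
  + bracket X (bracket Y (sl2_mx 0 0 1)) 1 0.

Definition SL2int : set SL2 := [set g | forall i j, pint F (g i j)].

Definition torus1 : set SL2 :=
  [set g | exists a b : F, a ^+ 2 - b ^+ 2 = 1 /\ g = mx2 a b b a :> 'M[F]_2].

Fact mx2M (a b c d a' b' c' d' : F) :
  mx2 a b c d * mx2 a' b' c' d' =
  mx2 (a * a' + b * c') (a * b' + b * d') (c * a' + d * c') (c * b' + d * d').
Proof.
apply/matrixP=> i j; rewrite !mxE big_ord_recl big_ord1 !mxE /=.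
by case: i j => [[|[|//]] ?] [[|[|//]] ?].
Qed.

Fact mx2_1 : 1 = mx2 1 0 0 1 :> 'M[F]_2.
Proof.
by apply/matrixP=> i j; rewrite !mxE; case: i j => [[|[|//]] ?] [[|[|//]] ?].
Qed.

Fact torus1_one : torus1 1%g.
Proof. by exists 1, 0; rewrite expr0n subr0 expr1n -mx2_1. Qed.

Fact torus1M g h : torus1 g -> torus1 h -> torus1 (g * h)%g.
Proof.
move=> [a [b [ab gE]]] [c [d [cd hE]]].
exists (a * c + b * d), (a * d + b * c); split; last first.
  by rewrite /= gE hE mx2M [b * c + _]addrC [b * d + _]addrC.
by rewrite -[RHS]mulr1 -{1}ab -cd; ring.
Qed.

Fact torus1V g : torus1 g -> torus1 g^-1%g.
Proof.
move=> [a [b [ab gE]]]; exists a, (- b); split; first by rewrite sqrrN.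
apply: (mulrI (SL2_unit g)); rewrite /= mulrV ?SL2_unit // gE.
by rewrite mx2M mx2_1 -ab; congr mx2; ring.
Qed.

Definition torus1_rel g h : bool := `[< exists2 a, torus1 a & h = (a * g)%g >].

Fact torus1_rel_refl : reflexive torus1_rel.
Proof.
by move=> g; apply/asboolP; exists 1%g; rewrite ?mul1g//; exact: torus1_one.
Qed.

Fact torus1_rel_sym : symmetric torus1_rel.
Proof.
move=> g h; apply/idP/idP => /asboolP[a ha ->]; apply/asboolP;
  by exists a^-1%g; rewrite ?mulKg//; exact: torus1V.
Qed.

Fact torus1_rel_trans : transitive torus1_rel.
Proof.
move=> h g k /asboolP[a ha ->] /asboolP[b hb ->]; apply/asboolP.
by exists (b * a)%g; rewrite ?mulgA//; exact: torus1M.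
Qed.

Canonical torus1_equiv :=
  EquivRel torus1_rel torus1_rel_refl torus1_rel_sym torus1_rel_trans.

(** The space of cosets [torus1] g, with the quotient topology. *)
Definition torus1_quot : Type := quotient_topology {eq_quot torus1_equiv}%qT.
HB.instance Definition _ := Quotient.on torus1_quot.
HB.instance Definition _ := Topological.on torus1_quot.
HB.instance Definition _ := Pointed.on torus1_quot.

(** Weil's formula.  The inner integral on the right does not depend on the choice of the
    representative, [muA] being invariant; a Borel measure on the quotient is
    determined by this formula. *)
Definition is_quotient_measure (muG muA : {measure set (borel SL2) -> \bar R})
    (muQ : {measure set (borel torus1_quot) -> \bar R}) : Prop :=
  forall phi : SL2 -> R, continuous phi -> compactly_supported phi ->
    (\int[muG]_g (phi g)%:E =
     \int[muQ]_x \int[muA]_(a in torus1) (phi (a * repr x)%g)%:E)%E.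

Definition fourier (psi : F -> R[i]) (mug : {measure set (borel sl2) -> \bar R})
    (f : sl2 -> R[i]) : sl2 -> R[i] :=
  fun Y => cintegral mug setT (fun X : sl2 => f X * psi (killing X Y)).

Definition Kaverage (muK : {measure set (borel SL2) -> \bar R})
    (f : sl2 -> R[i]) : sl2 -> R[i] :=
  fun X => cintegral muK SL2int (fun k : SL2 => f (adj k X)).

(** The normalization of the Haar measure on the Lie algebra: the integral of
    the Fourier transform of f over the diagonal matrices, for dh, equals the
    integral of f over the antidiagonal matrices, for db dc. *)
Definition fourier_normalized (mu : {measure set (borel F) -> \bar R})
    (psi : F -> R[i]) (mug : {measure set (borel sl2) -> \bar R}) : Prop :=
  forall f : sl2 -> R[i], locally_constant f -> compactly_supported f ->
    cintegral mu setT (fun a : F => fourier psi mug f (sl2_mx a 0 0)) =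
    cintegral mu setT (fun b : F =>
      cintegral mu setT (fun c : F => f (sl2_mx 0 b c))).

End Sl2.

Arguments SL2int {R} F.
Arguments torus1 {R} F.

(* Main.v *)
Require Import Defs.
From mathcomp Require Import all_boot all_order all_algebra.
From mathcomp Require Import all_classical all_reals all_analysis complex.
From mathcomp Require Import measurable_realfun ring.

Set Implicit Arguments.
Unset Strict Implicit.
Unset Printing Implicit Defensive.

Import Order.TTheory GRing.Theory Num.Theory.
Import numFieldNormedType.Exports.

Local Open Scope classical_set_scope.
Local Open Scope complex_scope.
Local Open Scope ring_scope.

(** Both sides equal the integral of the K-average of f over the upper
    triangular matrices [[b, x], [0, -b]], for db dx.

    Orbital side.  As 2 is a unit, some k0 in K diagonalizes every matrix X_b of
    t_1 at once, and the matrices [upper x] are k0 n(x) with n(x) unipotent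
    upper triangular.  The set [section] is k0 N K.  It meets every coset of
    A_1 in a translate of the integral torus, that is, in mass one
    ([torus_fiber_mass]), so Weil's formula replaces the integral over the
    quotient by an integral over [section] ([quotient_section]).  The indicator
    of [section] is the integral over x of the indicator of [upper x] K
    ([mu_section_fiber]); exchanging the integrals and translating by [upper x]
    yields the integral over x of the K-average of f at [[b, 2 b x], [0, -b]]
    ([orbital_integral]).  The factor |b| is the Jacobian of x |-> 2 b x.

    Fourier side.  The Fourier transform commutes with the action of K, hence
    with the K-average ([Kaverage_fourier]).  The cyclic permutation [rotate] of
    the coordinates of the Lie algebra preserves its Haar measure and carries the
    pairing with the diagonal to the pairing with the nilpotent line, so the
    identity that normalizes the measure becomes the one between the nilpotent
    line and its orthogonal complement, the upper triangular matrices
    ([fourier_nilpotent]).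

    Both sides use that a Haar measure is determined by its mass on open
    subgroups ([haar_unique], [haar_automorphism]): it gives the Jacobian, the
    invariance of the measure on the Lie algebra under K and [rotate], and the
    agreement of the measures of G and of K on K. *)

(** * The absolute value *)

Section Valuation.
Context {R : realType} {F : padicFieldType R}.
Implicit Types (x y z : F) (r e : R).
Local Notation pabs := (@pabs R F).

Lemma pabs0 : pabs (0 : F) = 0.
Proof. exact/pabs_eq0. Qed.

Lemma pabs_gt0 x : x != 0 -> 0 < pabs x.
Proof.
by move=> x0; rewrite lt_def pabs_ge0 andbT; apply: contra_neq x0 => /pabs_eq0.
Qed.

Lemma pabsV x : pabs x^-1 = (pabs x)^-1.
Proof.
have [->|x0] := eqVneq x 0; first by rewrite invr0 pabs0 invr0.
by apply: (mulfI (lt0r_neq0 (pabs_gt0 x0)));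
   rewrite -pabsM !divff ?pabs1 ?gt_eqF ?pabs_gt0.
Qed.

Lemma pabsX x n : pabs (x ^+ n) = pabs x ^+ n.
Proof. by elim: n => [|n IHn]; rewrite ?expr0 ?pabs1// !exprS pabsM IHn. Qed.

Lemma pabsD_le x y r : pabs x <= r -> pabs y <= r -> pabs (x + y) <= r.
Proof. by move=> xr yr; rewrite (le_trans (pabs_ultra x y))// ge_max xr. Qed.

Lemma pabsB_le x y r : pabs x <= r -> pabs y <= r -> pabs (x - y) <= r.
Proof. by move=> xr yr; apply: pabsD_le; rewrite ?pabsN. Qed.

Lemma pabsD_lt x y r : pabs x < r -> pabs y < r -> pabs (x + y) < r.
Proof. by move=> xr yr; rewrite (le_lt_trans (pabs_ultra x y))// gt_max xr. Qed.

Lemma pabsB_lt x y r : pabs x < r -> pabs y < r -> pabs (x - y) < r.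
Proof. by move=> xr yr; apply: pabsD_lt; rewrite ?pabsN. Qed.

Lemma pabs_distC x y : pabs (x - y) = pabs (y - x).
Proof. by rewrite -pabsN opprB. Qed.

Lemma pabsB_lt_trans y x z r :
  pabs (x - y) < r -> pabs (y - z) < r -> pabs (x - z) < r.
Proof. by move=> xy yz; rewrite -[x](subrK y) -addrA; apply: pabsD_lt. Qed.

Lemma pabs_eq_close x y : pabs (x - y) < pabs x -> pabs y = pabs x.
Proof.
move=> xy; apply/eqP; rewrite eq_le; apply/andP; split.
  by rewrite -[y](subKr x); apply: pabsB_le => //; apply: ltW.
rewrite leNgt; apply/negP => yx.
by have := pabsD_lt xy yx; rewrite subrK ltxx.
Qed.

(** Representatives of the residue field split a ball into finitely many
    translates of the next smaller one; this serves both for compactness and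
    for the mass of balls. *)
Lemma residue_system : exists (k : finFieldType) (w : F) (rep : k -> F),
  0 < pabs w < 1 /\
  [/\ forall x, pabs x < 1 -> pabs x <= pabs w, forall a, pabs (rep a) <= 1,
      pabs w = #|k|%:R^-1,
      forall a b, pabs (rep a - rep b) < 1 -> a = b &
      forall x, pabs x <= 1 -> exists a, pabs (x - rep a) <= pabs w].
Proof.
have [k [res [w [[resD resM res1 res0 ressurj] w01 wmax wq]]]] :=
  @pabs_normalized R F.
have /choice[rep repP] a : exists x, pabs x <= 1 /\ res x = a.
  by have [x x1 xa] := ressurj a; exists x.
have resB x y : pabs x <= 1 -> pabs y <= 1 -> res (x - y) = res x - res y.
  move=> x1 y1; apply/eqP; rewrite eq_sym subr_eq -resD ?subrK//.
  exact: pabsB_le.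
exists k, w, rep; split => //; split => // [a|a b ab|x x1].
- by have [] := repP a.
- have [a1 ra] := repP a; have [b1 rb] := repP b; rewrite -ra -rb.
  by apply/eqP; rewrite -subr_eq0 -resB//; apply/eqP/res0 => //; exact: ltW.
- have [a1 ra] := repP (res x); exists (res x); apply: wmax.
  by apply/res0; [exact: pabsB_le | rewrite resB// ra subrr].
Qed.

Lemma pabs_uniformizer : exists w : F, 0 < pabs w < 1.
Proof. by have [k [w [rep [w01 _]]]] := residue_system; exists w. Qed.

Lemma pabs_small r : 0 < r -> exists2 x : F, x != 0 & pabs x < r.
Proof.
move=> r0; have [w /andP[w0 w1]] := pabs_uniformizer.
have w0' : w != 0 by apply: contraTneq w0 => ->; rewrite pabs0 ltxx.
have /cvgrPdist_lt/(_ r r0)[N _ /(_ N (leqnn N))] :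
    pabs w ^+ n @[n --> \oo] --> (0 : R).
  by apply: cvg_expr; rewrite ger0_norm ?ltW.
rewrite /= sub0r normrN ger0_norm ?exprn_ge0 ?ltW// => wr.
by exists (w ^+ N); rewrite ?expf_neq0// pabsX.
Qed.

Lemma pabs_large r : exists2 x : F, x != 0 & r < pabs x.
Proof.
have r1 : 0 < `|r| + 1 by rewrite ltr_wpDl.
have [|x x0 xr] := @pabs_small (`|r| + 1)^-1; first by rewrite invr_gt0.
exists x^-1; first by rewrite invr_eq0.
rewrite pabsV (@le_lt_trans _ _ `|r|) ?ler_norm//.
rewrite (@lt_le_trans _ _ (`|r| + 1)) ?ltrDl//.
by rewrite -[leLHS]invrK lef_pV2 ?posrE ?invr_gt0 ?pabs_gt0// ltW.
Qed.

(** Balls are totally bounded because the residue field is finite: the net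
    consists of the expansions with n digits in the uniformizer. *)
Lemma pball_net r e : 0 < e -> exists s : seq F,
  forall x, pabs x <= r -> exists2 d, d \in s & pabs (x - d) < e.
Proof.
have [k [w [rep [/andP[w0 w1] [_ _ _ _ repP]]]]] := residue_system.
have w0' : w != 0 by apply: contraTneq w0 => ->; rewrite pabs0 ltxx.
have net1 n : exists s : seq F, forall x, pabs x <= 1 ->
    exists2 d, d \in s & pabs (x - d) <= pabs w ^+ n.
  elim: n => [|n [s sP]].
    by exists [:: 0] => x x1; exists 0; rewrite ?mem_head// subr0 expr0.
  exists [seq d + w ^+ n * rep a | d <- s, a <- enum k] => x /sP[d ds xd].
  have [|a ha] := repP ((x - d) / w ^+ n).
    by rewrite pabsM pabsV pabsX ler_pdivrMr ?exprn_gt0// mul1r.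
  exists (d + w ^+ n * rep a); first by apply: allpairs_f; rewrite ?mem_enum.
  have -> : x - (d + w ^+ n * rep a) = w ^+ n * ((x - d) / w ^+ n - rep a).
    by rewrite mulrBr mulrCA divff ?expf_neq0// mulr1; ring.
  by rewrite pabsM pabsX exprSr ler_pM2l// exprn_gt0.
move=> e0; have [c c0 rc] := pabs_large r.
have pc := pabs_gt0 c0.
have /cvgrPdist_lt/(_ (e / pabs c) (divr_gt0 e0 pc))[N _ /(_ N (leqnn N))] :
    pabs w ^+ n @[n --> \oo] --> (0 : R).
  by apply: cvg_expr; rewrite ger0_norm ?ltW.
rewrite /= sub0r normrN ger0_norm ?exprn_ge0 ?ltW// => wr.
have [s sP] := net1 N; exists [seq c * d | d <- s] => x xr.
have [|d ds xd] := sP (x / c).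
  by rewrite pabsM pabsV ler_pdivrMr// mul1r (le_trans xr)// ltW.
exists (c * d); first by apply: map_f.
have -> : x - c * d = (x / c - d) * c by rewrite mulrBl divfK// mulrC.
by rewrite pabsM -ltr_pdivlMr// (le_lt_trans xd).
Qed.

(** No absolute value lies strictly between two consecutive powers of the
    uniformizer. *)
Lemma pabs_value_group w : 0 < pabs w < 1 ->
  (forall x, pabs x < 1 -> pabs x <= pabs w) ->
  forall x, x != 0 -> exists n, pabs x = pabs w ^+ n \/ pabs x = pabs w ^- n.
Proof.
move=> /andP[w0 w1] wmax.
have small x : x != 0 -> pabs x <= 1 -> exists n, pabs x = pabs w ^+ n.
  move=> x0 x1; have px := pabs_gt0 x0.
  have ex : exists n, pabs w ^+ n < pabs x.
    have /cvgrPdist_lt/(_ _ px)[N _ /(_ N (leqnn N))] :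
        pabs w ^+ n @[n --> \oo] --> (0 : R).
      by apply: cvg_expr; rewrite ger0_norm ?ltW.
    by rewrite /= sub0r normrN ger0_norm ?exprn_ge0 ?ltW// => wr; exists N.
  case: (ex_minnP ex) => -[|n] nx nmin; first by rewrite expr0 ltNge x1 in nx.
  exists n; have xn : pabs x <= pabs w ^+ n.
    by rewrite leNgt; apply/negP => /nmin; rewrite ltnn.
  apply/eqP; rewrite eq_le xn leNgt/=; apply/negP => xn'.
  have : pabs (x / w ^+ n) < 1 by rewrite pabsM pabsV pabsX ltr_pdivrMr ?mul1r ?exprn_gt0.
  move/wmax; rewrite pabsM pabsV pabsX ler_pdivrMr ?exprn_gt0// -exprS.
  by rewrite leNgt nx.
move=> x x0; have [x1|x1] := leP (pabs x) 1.
  by have [n xn] := small x x0 x1; exists n; left.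
have [||n] := small x^-1; rewrite ?invr_eq0// pabsV ?invf_le1 ?pabs_gt0 ?ltW//.
by move=> xn; exists n; right; rewrite -xn invrK.
Qed.

(** The image of 2 in a field of characteristic p > 2 is not zero. *)
Lemma pabs2_eq1 p : residue_char F p -> (2 < p)%N -> pabs (2%:R : F) = 1.
Proof.
move=> [k [res [[resD resM res1 res0 _] /andP[pp p0]]]] p2.
have le21 : pabs (2%:R : F) <= 1 by apply: pabsD_le; rewrite pabs1.
apply/eqP; rewrite eq_le le21 leNgt/=; apply/negP => /(res0 _ le21).
rewrite resD ?pabs1// res1 => /eqP k2.
have : (p %| 2)%N by rewrite (@dvdn_pcharf k) ?inE ?pp.
by move/dvdn_leq => /(_ isT); rewrite leqNgt p2.
Qed.

End Valuation.

(** * Topologies given by finitely many coordinates *)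

Section Coordinates.
Context {R : realType} {F : padicFieldType R}.
Local Notation pabs := (@pabs R F).

(** F, its Lie algebra and its group all have boxes in finitely many coordinates
    as neighbourhoods; compactness, second countability and continuity are
    proved once from this. *)
Definition coordinates (T : topologicalType) (I : finType) (c : I -> T -> F) :=
  forall (x : T) (A : set T), nbhs x A <->
    exists2 e : R, 0 < e & forall y, (forall i, pabs (c i x - c i y) < e) -> A y.

Lemma coordinates_padic : coordinates (fun _ : unit => (@id F : F -> F)).
Proof.
move=> x A; split=> [/nbhs_ballP[e /= e0 eA]|[e e0 eA]].
  exists e => // y xy; apply: eA; rewrite ballEmdist/=; exact: (xy tt).
apply/nbhs_ballP; exists e => // y; rewrite ballEmdist/= => xy.
by apply: eA => _.
Qed.

Lemma coordinates_mx (S : choiceType) m n (f : S -> 'M[F]_(m, n)) :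
  coordinates (fun (ij : 'I_m * 'I_n) (x : initial_topology f) => f x ij.1 ij.2).
Proof.
move=> x A; split.
  move=> [_ [[B oB <-] /= Bx] BA].
  have /nbhs_ballP[e e0 eB] : nbhs (f x) B by apply: open_nbhs_nbhs.
  exists e => // y xy; apply: BA; apply: eB; split=> // i j.
  by rewrite ballEmdist/=; exact: (xy (i, j)).
move=> [e e0 eA].
have fx : nbhs (f x) (ball (f x) e) by apply: nbhsx_ballx.
have h : nbhs x (f @^-1` ball (f x) e) by apply: initial_continuous fx.
apply: filterS h => y [_ xy].
apply: eA => -[i j]; move: (xy i j).
by rewrite ballEmdist.
Qed.

Lemma coordinates_sl2 :
  coordinates (fun (ij : 'I_2 * 'I_2) (X : sl2 F) => X ij.1 ij.2).
Proof. exact: coordinates_mx. Qed.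

Lemma coordinates_SL2 :
  coordinates (fun (ij : 'I_2 * 'I_2) (g : SL2 F) => g ij.1 ij.2).
Proof. exact: coordinates_mx. Qed.

Section Theory.
Context {T : topologicalType} {I : finType} {c : I -> T -> F}.
Hypothesis cT : coordinates c.

Lemma coord_continuous i : continuous (c i).
Proof.
move=> x A /coordinates_padic[e e0 eA]; apply/cT; exists e => // y xy.
by apply: eA => _; exact: xy.
Qed.

Lemma continuous_coord (S : topologicalType) (f : S -> T) :
  (forall i, continuous (c i \o f)) -> continuous f.
Proof.
move=> cf x A /cT[e e0 eA].
suff : \forall y \near x, forall i, pabs (c i (f x) - c i (f y)) < e.
  by apply: filterS => y xy; exact: eA.
apply: filter_forall => i; apply: (cf i x [set z | pabs (c i (f x) - z) < e]).
apply/coordinates_padic.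
by exists e => // y /(_ tt).
Qed.

Definition coord_ball (r : R) : set T := [set x | forall i, pabs (c i x) <= r].

Lemma near_coord (e : R) (x : T) :
  0 < e -> \forall y \near x, forall i, pabs (c i x - c i y) < e.
Proof. by move=> e0; apply/cT; exists e. Qed.

Lemma open_coord_ball r : 0 < r -> open (coord_ball r).
Proof.
move=> r0; rewrite openE => x xr; apply: filterS (near_coord x r0) => y xy i.
by rewrite -[c i y](subKr (c i x)); apply: pabsB_le => //; apply: ltW.
Qed.

Lemma closed_coord_ball r : closed (coord_ball r).
Proof.
move=> x xr i; rewrite leNgt; apply/negP => rx.
have x0 : 0 < pabs (c i x).
  by rewrite lt_def pabs_ge0 andbT; apply: contraTneq rx => /pabs_eq0 xi0;
     rewrite xi0 pabs0 -leNgt; have [y [/(_ i)/(le_trans (pabs_ge0 _))]] := xr _ (filterT).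
have [y [/(_ i) yr /(_ i) xy]] := xr _ (near_coord x x0).
by move: rx; rewrite -(pabs_eq_close xy) ltNge yr.
Qed.

(** The image of T under the coordinates is closed. *)
Hypothesis c_closed : forall a : I -> F,
  (forall e : R, 0 < e -> exists x, forall i, pabs (c i x - a i) < e) ->
  exists x, forall i, c i x = a i.

(** An ultrafilter containing a ball has Cauchy coordinates, by total
    boundedness; completeness and closedness of the image provide a limit. *)
Lemma compact_coord_ball r : compact (coord_ball r).
Proof.
rewrite compact_ultra => U UU Ur.
have near_pt i (e : R) : 0 < e -> exists d, U [set x | pabs (c i x - d) < e].
  move=> e0; have [s sP] := @pball_net R F r e e0.
  apply: contrapT => /forallNP nU.
  have : U (\bigcap_(d in [set` s]) [set x | ~ pabs (c i x - d) < e]).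
    suff H s' : U (\bigcap_(d in [set` (s' : seq F)]) [set x | ~ pabs (c i x - d) < e]).
      exact: H.
    elim: s' => [|d s' IH]; first by apply: filterS filterT => x _ d; rewrite /= in_nil.
    have [//|Ud] := in_ultra_setVsetC [set x | pabs (c i x - d) < e] UU; first by move/nU.
    apply: filterS (filterI (Ud : U [set x | ~ pabs (c i x - d) < e]) IH) => x [xd xs] d'.
    rewrite /= in_cons => /orP[/eqP->//|].
    exact: xs.
  move=> Us; have [x [xr xs]] := filter_ex (filterI Ur Us).
  by have [d ds xd] := sP _ (xr i); exact: (xs d ds).
have npos n : 0 < n.+1%:R^-1 :> R by rewrite invr_gt0.
have /choice[a aP] i : exists a, forall e : R, 0 < e -> U [set x | pabs (c i x - a) < e].
  have /choice[d dP] n := near_pt i _ (npos n).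
  (* Two sets of the ultrafilter meet, so the centres form a Cauchy sequence. *)
  have dd m n : pabs (d m - d n) < Num.max m.+1%:R^-1 n.+1%:R^-1.
    have [x [xm xn]] := filter_ex (filterI (dP m) (dP n)).
    apply: (@pabsB_lt_trans _ _ (c i x)); last by rewrite lt_max xn orbT.
    by rewrite pabs_distC lt_max xm.
  have [|l lP] := @padic_complete R F d.
    move=> e e0; have [N _ NP] := near_infty_natSinv_lt (PosNum e0).
    exists N => m n mN nN; apply: lt_trans (dd m n) _.
    by rewrite gt_max !NP.
  exists l => e e0; have [N1 _ N1P] := near_infty_natSinv_lt (PosNum e0).
  have [N2 N2P] := lP e e0; pose n := maxn N1 N2.
  apply: filterS (dP n) => x xn; apply: (@pabsB_lt_trans _ _ (d n)).
    by apply: lt_trans xn _; apply: N1P => /=; exact: leq_maxl.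
  by apply: N2P; exact: leq_maxr.
have Ua (e : R) : 0 < e -> U [set x | forall i, pabs (c i x - a i) < e].
  by move=> e0; apply: filter_forall => i; exact: aP.
have [|x xa] := c_closed (a := a).
  by move=> e e0; have [x xe] := filter_ex (Ua e e0); exists x.
have Ux : U --> x.
  move=> A /cT[e e0 eA]; apply: filterS (Ua e e0) => y ya; apply: eA => i.
  by rewrite xa pabs_distC.
exists x; split => //.
by apply: (@closed_coord_ball r) => A xA; exact: (filter_ex (filterI Ur (Ux _ xA))).
Qed.

(** The basic boxes are centred at points of finite nets; a centre is recorded by
    the positions of its coordinates in the net. *)
Lemma second_countable_coord : @second_countable T.
Proof.
have npos n : 0 < n.+1%:R^-1 :> R by rewrite invr_gt0.
have /choice[s sP] (mn : nat * nat) : exists s : seq F, forall x, pabs x <= mn.1%:R ->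
    exists2 d, d \in s & pabs (x - d) < mn.2.+1%:R^-1.
  exact: pball_net.
pose B (u : nat * nat * {ffun I -> nat}) : set T :=
  [set x | forall i, pabs (c i x - nth 0 (s u.1) (u.2 i)) < u.1.2.+1%:R^-1].
have oB u : open (B u).
  rewrite openE => x xB; apply: filterS (near_coord x (npos u.1.2)) => y xy i.
  by apply: (@pabsB_lt_trans _ _ (c i x)); rewrite // pabs_distC.
exists (range B); first by apply: sub_countable (countableP setT); exact: card_image_le.
split=> [_ [u _ <-] //|x A /cT[e e0 eA]].
have [n _ /(_ n (leqnn n)) ne] := near_infty_natSinv_lt (PosNum e0).
pose m := (\max_i (Num.truncn (pabs (c i x))).+1)%N.
have xm i : pabs (c i x) <= m%:R.
  rewrite (le_trans (ltW (truncnS_gt _)))// ler_nat.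
  exact: (leq_bigmax (F := fun i => (Num.truncn (pabs (c i x))).+1)).
have kP i : exists k, pabs (c i x - nth 0 (s (m, n)) k) < n.+1%:R^-1.
  have [d ds xd] := sP (m, n) _ (xm i); exists (index d (s (m, n))).
  by rewrite nth_index.
have /choice[k kk] := kP.
pose u : nat * nat * {ffun I -> nat} := (m, n, [ffun i => k i]).
have Bux : B u x by move=> i; rewrite /= ffunE.
exists (B u); first by split=> //; exists u.
move=> y yB; apply: eA => i; apply: lt_trans ne.
by apply: (pabsB_lt_trans (Bux i)); rewrite pabs_distC.
Qed.

End Theory.
End Coordinates.
Arguments coord_ball {R F T I} c r _.

(** * Two by two matrices and continuity of the group operations *)

Section Matrix2.
Context {A : fieldType}.
Implicit Types X Y : 'M[A]_2.

Lemma mx2_eta X : X = mx2 (X 0 0) (X 0 1) (X 1 0) (X 1 1).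
Proof.
by apply/matrixP=> i j; rewrite !mxE; case: i j => [[|[|//]] ?] [[|[|//]] ?] /=;
   congr (X _ _); exact: val_inj.
Qed.

Lemma det_mx2 X : \det X = X 0 0 * X 1 1 - X 0 1 * X 1 0.
Proof.
rewrite {1}[X]mx2_eta (expand_det_row _ 0) big_ord_recl big_ord1 /cofactor.
by rewrite !det_mx11 !mxE /= expr0 expr1; ring.
Qed.

Lemma forall_mx2 (P : 'I_2 -> 'I_2 -> Prop) :
  P 0 0 -> P 0 1 -> P 1 0 -> P 1 1 -> forall i j, P i j.
Proof.
move=> a b c d [[|[|//]] hi] [[|[|//]] hj].
- by have -> : Ordinal hi = 0 by [exact: val_inj]; have -> : Ordinal hj = 0 by exact: val_inj.
- by have -> : Ordinal hi = 0 by [exact: val_inj]; have -> : Ordinal hj = 1 by exact: val_inj.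
- by have -> : Ordinal hi = 1 by [exact: val_inj]; have -> : Ordinal hj = 0 by exact: val_inj.
- by have -> : Ordinal hi = 1 by [exact: val_inj]; have -> : Ordinal hj = 1 by exact: val_inj.
Qed.

End Matrix2.

Section ContinuousAlgebra.
Context {R : realType} {F : padicFieldType R} {S : topologicalType}.
Local Notation pabs := (@pabs R F).
Implicit Types f g : S -> F.

Lemma pcontinuousP f : continuous f <->
  forall x (e : R), 0 < e -> \forall y \near x, pabs (f x - f y) < e.
Proof.
split=> [cf x e e0|H x A /coordinates_padic[e e0 eA]].
  apply: (cf x [set z | pabs (f x - z) < e]).
  by apply/coordinates_padic; exists e => // y /(_ tt).
by apply: filterS (H x e e0) => y xy; exact: eA.
Qed.

Lemma pcontinuousD f g : continuous f -> continuous g ->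
  continuous (fun s => f s + g s).
Proof.
move=> /pcontinuousP cf /pcontinuousP cg; apply/pcontinuousP => x e e0.
apply: filterS2 (cf x e e0) (cg x e e0) => y fy gy.
by rewrite opprD addrACA pabsD_lt.
Qed.

Lemma pcontinuousN f : continuous f -> continuous (fun s => - f s).
Proof.
move=> /pcontinuousP cf; apply/pcontinuousP => x e e0.
by apply: filterS (cf x e e0) => y fy; rewrite -opprD pabsN.
Qed.

Lemma pcontinuousM f g : continuous f -> continuous g ->
  continuous (fun s => f s * g s).
Proof.
move=> /pcontinuousP cf /pcontinuousP cg; apply/pcontinuousP => x e e0.
pose a := pabs (f x) + 1; pose b := pabs (g x) + 1.
have a0 : 0 < a by rewrite ltr_wpDl ?pabs_ge0.
have b0 : 0 < b by rewrite ltr_wpDl ?pabs_ge0.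
apply: filterS3 (cf x _ (divr_gt0 e0 b0)) (cg x _ (divr_gt0 e0 a0)) (cg x _ ltr01).
move=> y fy gy gy1.
have -> : f x * g x - f y * g y = f x * (g x - g y) + (f x - f y) * g y by ring.
apply: pabsD_lt; rewrite pabsM.
  rewrite (@le_lt_trans _ _ (a * pabs (g x - g y))) ?ler_wpM2r ?pabs_ge0 ?lerDl//.
  by rewrite mulrC -ltr_pdivlMr.
rewrite (@le_lt_trans _ _ (pabs (f x - f y) * b)) ?ler_wpM2l ?pabs_ge0//.
  rewrite -[g y](subKr (g x)); apply: pabsB_le; first by rewrite lerDl.
  by rewrite (le_trans (ltW gy1))// lerDr pabs_ge0.
by rewrite -ltr_pdivlMr.
Qed.

Definition mxcontinuous (M : S -> 'M[F]_2) :=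
  forall i j, continuous (fun s => M s i j).

Lemma mxcontinuousM (M N : S -> 'M[F]_2) :
  mxcontinuous M -> mxcontinuous N -> mxcontinuous (fun s => M s * N s).
Proof.
move=> cM cN i j.
under [X in continuous X]eq_fun do rewrite mxE big_ord_recl big_ord1.
by apply: pcontinuousD; apply: pcontinuousM.
Qed.

Lemma mxcontinuousD (M N : S -> 'M[F]_2) :
  mxcontinuous M -> mxcontinuous N -> mxcontinuous (fun s => M s + N s).
Proof.
move=> cM cN i j; under [X in continuous X]eq_fun do rewrite mxE.
exact: pcontinuousD.
Qed.

Lemma mxcontinuousN (M : S -> 'M[F]_2) :
  mxcontinuous M -> mxcontinuous (fun s => - M s).
Proof.
move=> cM i j; under [X in continuous X]eq_fun do rewrite mxE.
exact: pcontinuousN.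
Qed.

Lemma mxcontinuous_mx2 (a b c d : S -> F) : continuous a -> continuous b ->
  continuous c -> continuous d -> mxcontinuous (fun s => mx2 (a s) (b s) (c s) (d s)).
Proof.
move=> ca cb cc cd; apply: forall_mx2;
  by under [X in continuous X]eq_fun do rewrite mxE /=.
Qed.

Lemma continuous_sl2P (X : S -> sl2 F) :
  continuous X <-> mxcontinuous (fun s => X s : 'M[F]_2).
Proof.
split=> [cX i j s|cX].
  have := @continuous_comp _ _ _ X (fun Y : sl2 F => Y i j) s (cX s).
  by apply; exact: (@coord_continuous _ _ _ _ _ coordinates_sl2 (i, j)).
by apply: (continuous_coord coordinates_sl2) => -[i j]; exact: cX.
Qed.

Lemma continuous_SL2P (g : S -> SL2 F) :
  continuous g <-> mxcontinuous (fun s => g s : 'M[F]_2).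
Proof.
split=> [cX i j s|cX].
  have := @continuous_comp _ _ _ g (fun Y : SL2 F => Y i j) s (cX s).
  by apply; exact: (@coord_continuous _ _ _ _ _ coordinates_SL2 (i, j)).
by apply: (continuous_coord coordinates_SL2) => -[i j]; exact: cX.
Qed.

Lemma SL2_invE (g : SL2 F) : (g : 'M[F]_2)^-1 = mx2 (g 1 1) (- g 0 1) (- g 1 0) (g 0 0).
Proof.
apply: (mulrI (SL2_unit g)); rewrite mulrV ?SL2_unit//.
rewrite [X in _ = X * _]mx2_eta mx2M mx2_1 -(SL2_det g) det_mx2.
by congr mx2; ring.
Qed.

Lemma mxcontinuousV (g : S -> SL2 F) :
  continuous g -> mxcontinuous (fun s => (g s : 'M[F]_2)^-1).
Proof.
move=> /continuous_SL2P cg; under [X in mxcontinuous X]eq_fun do rewrite SL2_invE.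
by apply: mxcontinuous_mx2; try apply: pcontinuousN; exact: cg.
Qed.

Lemma continuousMg (g h : S -> SL2 F) :
  continuous g -> continuous h -> continuous (fun s => (g s * h s)%g).
Proof.
by move=> /continuous_SL2P cg /continuous_SL2P ch; apply/continuous_SL2P; exact: mxcontinuousM.
Qed.

Lemma continuousVg (g : S -> SL2 F) : continuous g -> continuous (fun s => (g s)^-1%g).
Proof. by move=> cg; apply/continuous_SL2P; exact: mxcontinuousV. Qed.

Lemma continuous_adj (g : S -> SL2 F) (X : S -> sl2 F) :
  continuous g -> continuous X -> continuous (fun s => adj (g s) (X s)).
Proof.
move=> cg /continuous_sl2P cX; apply/continuous_sl2P.
apply: mxcontinuousM; last exact/continuous_SL2P.
by apply: mxcontinuousM => //; exact: mxcontinuousV.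
Qed.

Lemma continuous_sl2_mx (a b c : S -> F) :
  continuous a -> continuous b -> continuous c ->
  continuous (fun s => sl2_mx (a s) (b s) (c s)).
Proof.
move=> ca cb cc; apply/continuous_sl2P; apply: mxcontinuous_mx2 => //.
exact: pcontinuousN.
Qed.

Lemma continuousDsl2 (X Y : S -> sl2 F) :
  continuous X -> continuous Y -> continuous (fun s => X s + Y s).
Proof.
move=> /continuous_sl2P cX /continuous_sl2P cY; apply/continuous_sl2P.
exact: mxcontinuousD.
Qed.

Lemma continuousNsl2 (X : S -> sl2 F) :
  continuous X -> continuous (fun s => - X s).
Proof. by move=> /continuous_sl2P cX; apply/continuous_sl2P; exact: mxcontinuousN. Qed.

End ContinuousAlgebra.

(** * Compact open balls *)

Section Compactness.
Context {R : realType} {F : padicFieldType R}.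
Local Notation pabs := (@pabs R F).

Lemma pabs_small_eq0 (x : F) : (forall e : R, 0 < e -> pabs x < e) -> x = 0.
Proof.
move=> xe; apply/eqP/negP => /negP/pabs_gt0/xe; by rewrite ltxx.
Qed.

Lemma closed_image_padic (a : unit -> F) :
  (forall e : R, 0 < e -> exists x, forall i, pabs (id x - a i) < e) ->
  exists x, forall i, id x = a i.
Proof. by move=> _; exists (a tt) => -[]. Qed.

Lemma closed_image_sl2 (a : 'I_2 * 'I_2 -> F) :
  (forall e : R, 0 < e -> exists x : sl2 F, forall ij, pabs (x ij.1 ij.2 - a ij) < e) ->
  exists x : sl2 F, forall ij, x ij.1 ij.2 = a ij.
Proof.
move=> aP; have tr0 : a (0, 0) + a (1, 1) = 0.
  apply: pabs_small_eq0 => e e0; have [x xa] := aP e e0.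
  have := valP x; rewrite unfold_in /mxtrace big_ord_recl big_ord1.
  have -> : lift ord0 ord0 = 1 :> 'I_2 by exact: val_inj.
  move=> /eqP x0; rewrite -pabsN -[X in pabs X]addr0 -x0.
  have -> : - (a (0, 0) + a (1, 1)) + (x 0 0 + x 1 1) =
    (x 0 0 - a (0, 0)) + (x 1 1 - a (1, 1)) by ring.
  by apply: pabsD_lt; [exact: (xa (0, 0)) | exact: (xa (1, 1))].
exists (sl2_mx (a (0, 0)) (a (0, 1)) (a (1, 0))) => -[i j] /=.
apply: (@forall_mx2 (fun i j => mx2 _ _ _ _ i j = a (i, j))); rewrite mxE//=.
by apply/eqP; rewrite eq_sym -subr_eq0 opprK addrC tr0.
Qed.

(** The determinant is continuous, so it is still 1 at a limit of coordinates. *)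
Lemma closed_image_SL2 (a : 'I_2 * 'I_2 -> F) :
  (forall e : R, 0 < e -> exists x : SL2 F, forall ij, pabs (x ij.1 ij.2 - a ij) < e) ->
  exists x : SL2 F, forall ij, x ij.1 ij.2 = a ij.
Proof.
move=> aP; pose A : 'M[F]_2 := \matrix_(i, j) a (i, j).
pose T := initial_topology (@id 'M[F]_2).
have cT := @coordinates_mx R F _ 2 2 (@id 'M[F]_2).
have cE i j : continuous (fun X : T => X i j) := coord_continuous cT (i := (i, j)).
have cdet : continuous (fun X : T => X 0 0 * X 1 1 - X 0 1 * X 1 0).
  by apply: pcontinuousD; last apply: pcontinuousN; apply: pcontinuousM; exact: cE.
have det1 : \det A == 1.
  rewrite -subr_eq0; apply/eqP/pabs_small_eq0 => e e0.
  have /cT[d /= d0 dP] := iffLR (pcontinuousP _) cdet A e e0.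
  have [x xa] := aP d d0; rewrite det_mx2 -(SL2_det x) det_mx2; apply: dP => ij.
  by rewrite mxE pabs_distC -surjective_pairing.
by exists (mkSL2 det1) => -[i j]; rewrite /= mxE.
Qed.

Definition pball (r : R) : set F := [set x | pabs x <= r].
Definition sl2_ball (r : R) : set (sl2 F) := [set X | forall i j, pabs (X i j) <= r].
Definition SL2_ball (r : R) : set (SL2 F) := [set g | forall i j, pabs (g i j) <= r].

Lemma pballE r : pball r = coord_ball (fun _ : unit => (@id F : F -> F)) r.
Proof. by apply/seteqP; split=> x xr; [move=> _ | exact: (xr tt)]. Qed.

Lemma sl2_ballE r :
  sl2_ball r = coord_ball (fun (ij : 'I_2 * 'I_2) (X : sl2 F) => X ij.1 ij.2) r.
Proof. by apply/seteqP; split=> x xr; [case|move=> i j; exact: (xr (i, j))]. Qed.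

Lemma SL2_ballE r :
  SL2_ball r = coord_ball (fun (ij : 'I_2 * 'I_2) (X : SL2 F) => X ij.1 ij.2) r.
Proof. by apply/seteqP; split=> x xr; [case|move=> i j; exact: (xr (i, j))]. Qed.

Lemma compact_pball r : compact (pball r).
Proof. rewrite pballE; exact: (compact_coord_ball coordinates_padic closed_image_padic). Qed.

Lemma compact_sl2_ball r : compact (sl2_ball r).
Proof. rewrite sl2_ballE; exact: (compact_coord_ball coordinates_sl2 closed_image_sl2). Qed.

Lemma compact_SL2_ball r : compact (SL2_ball r).
Proof. rewrite SL2_ballE; exact: (compact_coord_ball coordinates_SL2 closed_image_SL2). Qed.

Lemma closed_pball r : closed (pball r).
Proof. rewrite pballE; exact: (closed_coord_ball coordinates_padic). Qed.

Lemma closed_sl2_ball r : closed (sl2_ball r).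
Proof. rewrite sl2_ballE; exact: (closed_coord_ball coordinates_sl2). Qed.

Lemma closed_SL2_ball r : closed (SL2_ball r).
Proof. rewrite SL2_ballE; exact: (closed_coord_ball coordinates_SL2). Qed.

Lemma open_pball r : 0 < r -> open (pball r).
Proof. rewrite pballE; exact: (open_coord_ball coordinates_padic). Qed.

Lemma open_sl2_ball r : 0 < r -> open (sl2_ball r).
Proof. rewrite sl2_ballE; exact: (open_coord_ball coordinates_sl2). Qed.

Lemma open_SL2_ball r : 0 < r -> open (SL2_ball r).
Proof. rewrite SL2_ballE; exact: (open_coord_ball coordinates_SL2). Qed.

Lemma SL2intE : SL2int F = SL2_ball 1. Proof. by []. Qed.

Lemma second_countable_padic : @second_countable F.
Proof. exact: (second_countable_coord coordinates_padic). Qed.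

Lemma second_countable_sl2 : @second_countable (sl2 F).
Proof. exact: (second_countable_coord coordinates_sl2). Qed.

Lemma second_countable_SL2 : @second_countable (SL2 F).
Proof. exact: (second_countable_coord coordinates_SL2). Qed.

End Compactness.

(** * Borel sets *)

Section Borel.
Context {R : realType}.

Lemma borel_open (T : ptopologicalType) (A : set T) :
  open A -> measurable (A : set (borel T)).
Proof. exact: sub_sigma_algebra. Qed.

Lemma borel_closed (T : ptopologicalType) (A : set T) :
  closed A -> measurable (A : set (borel T)).
Proof.
by move=> cA; rewrite -[A]setCK; apply: measurableC; apply: borel_open; exact: closed_openC.
Qed.

(** With countable bases, an open set of the product is a countable union of open
    rectangles. *)
Lemma borel_open_prod (T1 T2 : ptopologicalType) (A : set (T1 * T2)) :
  @second_countable T1 -> @second_countable T2 ->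
  open A -> measurable (A : set (borel T1 * borel T2)%type).
Proof.
move=> [B1 cB1 [oB1 bB1]] [B2 cB2 [oB2 bB2]] oA.
pose P := [set p : set T1 * set T2 | (B1 p.1 /\ B2 p.2) /\ p.1 `*` p.2 `<=` A].
have -> : A = \bigcup_(p in P) (p.1 `*` p.2).
  apply/seteqP; split=> [[x y] Axy|z [p [_ pA] pz]]; last exact: pA.
  have [[V1 V2] /= [V1x V2y] VA] : nbhs (x, y) A by exact: open_nbhs_nbhs.
  have [U1 [BU1 U1x] U1V1] := bB1 x _ V1x.
  have [U2 [BU2 U2y] U2V2] := bB2 y _ V2y.
  exists (U1, U2) => //; split=> // -[u v] [/= /U1V1 uV /U2V2 vV].
  exact: VA.
rewrite bigcup_set_type; apply: countable_bigcupT_measurable.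
  rewrite (eq_countable (card_setT P)).
  apply: (@sub_countable _ _ _ (B1 `*` B2)); last exact: countableX.
  by apply: subset_card_le => p [].
move=> [p /= /set_mem[[Bp1 Bp2] _]]; apply: measurableX; apply: borel_open.
  exact: oB1.
exact: oB2.
Qed.

Lemma borel_measurable d (S : measurableType d) (T : ptopologicalType) (f : S -> T) :
  (forall A : set T, open A -> measurable (f @^-1` A)) ->
  measurable_fun [set: S] (f : S -> borel T).
Proof.
move=> H; apply: (@measurability _ _ S (borel T) setT f (@open T)) => // _ [A oA <-].
by rewrite setTI; exact: H.
Qed.

Lemma real_measurable d (S : measurableType d) (f : S -> R) :
  (forall A : set R, open A -> measurable (f @^-1` A)) ->
  measurable_fun [set: S] f.
Proof.
move=> H; apply: (measurability _ (RGenOInfty.measurableE R)) => //.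
move=> _ [_ [x ->] <-]; rewrite setTI; apply: H.
by rewrite set_itvE; exact: open_gt.
Qed.

Lemma continuous_borel_measurable (T T' : ptopologicalType) (f : T -> T') :
  continuous f -> measurable_fun [set: borel T] (f : borel T -> borel T').
Proof.
by move=> /continuousP cf; apply: borel_measurable => A oA; apply: borel_open; apply: cf.
Qed.

Lemma continuous_real_measurable (T : ptopologicalType) (f : T -> R) :
  continuous f -> measurable_fun [set: borel T] f.
Proof.
by move=> /continuousP cf; apply: real_measurable => A oA; apply: borel_open; apply: cf.
Qed.

Lemma continuous_borel_measurable2 (T1 T2 T' : ptopologicalType) (f : T1 * T2 -> T') :
  @second_countable T1 -> @second_countable T2 -> continuous f ->
  measurable_fun [set: (borel T1 * borel T2)%type] (f : _ -> borel T').
Proof.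
move=> s1 s2 /continuousP cf; apply: borel_measurable => A oA.
by apply: borel_open_prod => //; apply: cf.
Qed.

Lemma continuous_real_measurable2 (T1 T2 : ptopologicalType) (f : T1 * T2 -> R) :
  @second_countable T1 -> @second_countable T2 -> continuous f ->
  measurable_fun [set: (borel T1 * borel T2)%type] f.
Proof.
move=> s1 s2 /continuousP cf; apply: real_measurable => A oA.
by apply: borel_open_prod => //; apply: cf.
Qed.

End Borel.

(** * Real integrals *)

Section Integrals.
Context {R : realType}.

Lemma integrable_supported d (T : measurableType d) (m : {measure set T -> \bar R})
    (D : set T) (h : T -> R) (M : R) : measurable D -> (m D < +oo)%E ->
  measurable_fun setT h -> (forall x, `|h x| <= M) -> (forall x, ~ D x -> h x = 0) ->
  m.-integrable setT (EFin \o h).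
Proof.
move=> mD Doo mh hM h0.
have -> : EFin \o h = (EFin \o h) \_ D.
  apply/funext => x; rewrite patchE; case: ifPn => //.
  by rewrite notin_setE => /h0 /= ->.
apply: (iffLR (integrable_mkcond _ mD)); apply: measurable_bounded_integrable => //.
  exact: measurable_funTS.
exists M; split; first exact: num_real.
by move=> x Mx y _; exact: le_trans (hM y) (ltW Mx).
Qed.

Lemma integral_restr d (T : measurableType d) (m : {measure set T -> \bar R})
    (D : set T) (mD : measurable D) (Doo : (m D < +oo)%E) (h : T -> \bar R) :
  (forall x, ~ D x -> h x = 0%E) ->
  (\int[mfrestr mD Doo]_x h x = \int[m]_x h x)%E.
Proof.
move=> h0; have -> : h = h \_ D.
  apply/funext => x; rewrite patchE; case: ifPn => //.
  by rewrite notin_setE => /h0 ->.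
rewrite -!integral_mkcond; apply: eq_measure_integral => A mA AD.
by rewrite -[LHS]/(m (A `&` D)) setIidl.
Qed.

(** Cutting both measures down to the sides of the rectangle reduces this to
    Fubini's theorem for finite measures. *)
Lemma Rintegral_swap d1 d2 (T1 : measurableType d1) (T2 : measurableType d2)
    (m1 : {measure set T1 -> \bar R}) (m2 : {measure set T2 -> \bar R})
    (D1 : set T1) (D2 : set T2) (h : T1 * T2 -> R) (M : R) :
  measurable D1 -> measurable D2 -> (m1 D1 < +oo)%E -> (m2 D2 < +oo)%E ->
  measurable_fun setT h -> (forall z, `|h z| <= M) ->
  (forall x y, ~ (D1 x /\ D2 y) -> h (x, y) = 0) ->
  \int[m1]_x \int[m2]_y h (x, y) = \int[m2]_y \int[m1]_x h (x, y).
Proof.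
move=> mD1 mD2 oo1 oo2 mh hM h0.
have i2 x : m2.-integrable setT (EFin \o (fun y => h (x, y))).
  apply: (@integrable_supported _ _ _ D2 _ M) => //.
    by apply: measurableT_comp => //; exact: measurable_pair1.
  by move=> y nD; apply: h0 => -[].
have i1 y : m1.-integrable setT (EFin \o (fun x => h (x, y))).
  apply: (@integrable_supported _ _ _ D1 _ M) => //.
    by apply: measurableT_comp => //; exact: measurable_pair2.
  by move=> x nD; apply: h0 => -[].
have f2 x : (\int[m2]_y (h (x, y))%:E)%E \is a fin_num.
  exact: (integrable_fin_num measurableT (i2 x)).
have f1 y : (\int[m1]_x (h (x, y))%:E)%E \is a fin_num.
  exact: (integrable_fin_num measurableT (i1 y)).
rewrite /Rintegral.
under eq_integral => x _ do rewrite (fineK (f2 x)).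
under [in RHS]eq_integral => y _ do rewrite (fineK (f1 y)).
congr fine.
pose n1 := mfrestr mD1 oo1; pose n2 := mfrestr mD2 oo2.
have e2 x : (\int[m2]_y (h (x, y))%:E = \int[n2]_y (h (x, y))%:E)%E.
  by rewrite integral_restr// => y nD; rewrite h0// => -[].
have e1 y : (\int[m1]_x (h (x, y))%:E = \int[n1]_x (h (x, y))%:E)%E.
  by rewrite integral_restr// => x nD; rewrite h0// => -[].
rewrite -(integral_restr mD1 oo1); last first.
  by move=> x nD; apply: integral0_eq => y _; rewrite h0// => -[].
rewrite -(integral_restr mD2 oo2); last first.
  by move=> y nD; apply: integral0_eq => x _; rewrite h0// => -[].
under eq_integral do rewrite e2.
under [in RHS]eq_integral do rewrite e1.
apply: (@Fubini _ _ _ _ _ n1 n2 (EFin \o h)).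
apply: measurable_bounded_integrable => //.
  have : ((n1 \x n2)%E (setT `*` setT) < +oo)%E.
    rewrite product_measure1E//.
    by rewrite lte_mul_pinfty ?ge0_fin_numE// -ge0_fin_numE// fin_num_measure.
  by rewrite setXTT.
exists M; split; first exact: num_real.
by move=> x Mx y _; exact: le_trans (hM y) (ltW Mx).
Qed.

Lemma Rintegral_indic d (T : measurableType d) (m : {measure set T -> \bar R}) (A : set T) :
  measurable A -> \int[m]_x \1_A x = fine (m A).
Proof. by move=> mA; rewrite /Rintegral integral_indic// setIT. Qed.

(** The positive and negative parts are transported separately, and an infinite
    one is multiplied by k as well. *)
Lemma Rintegral_change d (T : measurableType d) (m : {measure set T -> \bar R})
    (phi : T -> T) (k : R) (f : T -> R) : 0 <= k -> measurable_fun setT phi ->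
  (forall A, measurable A -> m (phi @^-1` A) = (k%:E * m A)%E) ->
  measurable_fun setT f -> \int[m]_x f (phi x) = k * \int[m]_x f x.
Proof.
move=> k0 mphi mE mf; pose K := NngNum k0.
have ge0E (g : T -> \bar R) : measurable_fun setT g -> (forall x, (0 <= g x)%E) ->
    (\int[m]_x g (phi x) = k%:E * \int[m]_x g x)%E.
  move=> mg g0; rewrite -(ge0_integral_mscale m measurableT K)//.
  rewrite -(preimage_setT phi) -(ge0_integral_pushforward mphi)//.
  by apply: eq_measure_integral => A mA _; rewrite -[LHS]/(m (phi @^-1` A)) mE.
have mEf : measurable_fun setT (EFin \o f) by apply/measurable_EFinP.
rewrite /Rintegral (integralE _ _ (EFin \o f)).
have -> : (\int[m]_x (f (phi x))%:E =
    k%:E * \int[m]_x ((EFin \o f)^\+ x) - k%:E * \int[m]_x ((EFin \o f)^\- x))%E.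
  rewrite integralE; congr (_ - _)%E.
    rewrite -ge0E//; last exact: measurable_funepos.
    by apply: eq_integral => x _; rewrite !funeposE.
  rewrite -ge0E//; last exact: measurable_funeneg.
  by apply: eq_integral => x _; rewrite !funenegE.
have [->|kn0] := eqVneq k 0; first by rewrite !mul0e sube0 mul0r.
have kp : 0 < k by rewrite lt_def kn0.
case: (integral _ _ _) => [a| |]; case: (integral _ _ _) => [b| |];
  by rewrite ?gt0_muley ?gt0_muleNy ?lte_fin//= ?mulr0// mulrBr.
Qed.

End Integrals.

(** * Uniqueness of Haar measure *)

Section HaarUniqueness.
Context {R : realType} {T : ptopologicalType}.
(** The group law enters through left division, so that the additive groups and
    the matrix group share one argument. *)
Variables (op : T -> T -> T) (inv : T -> T).
Hypothesis T2 : @second_countable T.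
Hypothesis ldivK : forall x y, op (inv x) (op x y) = y.
Hypothesis lmulVK : forall x y, op x (op (inv x) y) = y.
Hypothesis inv_ldiv : forall x y, inv (op (inv x) y) = op (inv y) x.
Hypothesis inv_cont : continuous inv.
Hypothesis ldiv_cont : continuous (fun z : T * T => op (inv z.1) z.2).

Definition invariant_under (U : set T) (m : {measure set (borel T) -> \bar R}) :=
  forall (h : T) (A : set (borel T)), U h -> measurable A ->
    m [set x | A (op h x)] = m A.

Section OnSubgroup.
Variable U : set T.
Hypothesis oU : open U.
Hypothesis UM : forall x y, U x -> U y -> U (op x y).
Hypothesis UV : forall x, U x -> U (inv x).

(** Integrate the indicator of [x^-1 y \in A] over U * U in both orders: for
    fixed x the set of y is a translate of A, for fixed y the set of x is a
    translate of the inverse of A. *)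
Lemma haar_swap (m1 m2 : {measure set (borel T) -> \bar R}) (A : set (borel T)) :
  invariant_under U m1 -> invariant_under U m2 ->
  (m1 U < +oo)%E -> (m2 U < +oo)%E -> measurable A -> A `<=` U ->
  fine (m1 U) * fine (m2 A) = fine (m2 U) * fine (m1 (inv @^-1` A)).
Proof.
move=> inv1 inv2 oo1 oo2 mA AU; have mU := borel_open oU.
have mV : measurable (inv @^-1` A : set (borel T)).
  rewrite -[X in measurable X]setTI.
  by apply: (continuous_borel_measurable inv_cont) => //; exact: measurableT.
have VU : inv @^-1` A `<=` U.
  move=> x /= /AU Ux; rewrite -(ldivK x x) -inv_ldiv; apply: UV.
  by have <- := inv_ldiv x (op x x); rewrite ldivK.
pose C := (fun z : borel T * borel T => op (inv z.1) z.2) @^-1` A.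
have mC : measurable (C : set (borel T * borel T)%type).
  rewrite -[C]setTI; apply: (continuous_borel_measurable2 _ _ ldiv_cont) => //; exact: measurableT.
pose h (z : borel T * borel T) : R := \1_(U `*` setT `&` C) z.
have mD : measurable (U `*` setT `&` C : set (borel T * borel T)%type).
  by apply: measurableI => //; apply: measurableX => //; exact: measurableT.
have hE x y : h (x, y) = \1_U x * \1_[set y | A (op (inv x) y)] y.
  by rewrite /h !indicE -natrM mulnb in_setI in_setX in_setT andbT.
have hE' x y : h (x, y) = \1_U y * \1_[set x | (inv @^-1` A) (op (inv y) x)] x.
  rewrite hE !indicE -!natrM !mulnb; congr (nat_of_bool _)%:R.
  apply/andP/andP; rewrite !inE /= inv_ldiv => -[Uz Axy]; split => //.
    by rewrite -(lmulVK x y); apply: UM => //; exact: AU.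
  have := VU (op (inv y) x); rewrite /= inv_ldiv => /(_ Axy) Uyx.
  by rewrite -(lmulVK y x); exact: UM.
have mh : measurable_fun setT h by exact: measurable_indic.
have hM z : `|h z| <= 1 by rewrite /h indicE ger0_norm ?lern1 ?leq_b1.
have h0 x y : ~ (U x /\ U y) -> h (x, y) = 0.
  move=> nU; have [Ux|] := pselect (U x); last first.
    by move=> Ux; rewrite hE indicE memNset// mul0r.
  by rewrite hE' indicE memNset ?mul0r// => Uy; exact: nU.
have := @Rintegral_swap R _ _ _ _ m1 m2 U U h 1 mU mU oo1 oo2 mh hM h0.
have mtr (B : set (borel T)) x : measurable B ->
    measurable ([set y | B (op (inv x) y)] : set (borel T)).
  move=> mB; rewrite -[X in measurable X]setTI.
  have mx : measurable_fun setT
      ((fun z : borel T * borel T => op (inv z.1) z.2 : borel T) \o pair x).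
    by apply: measurableT_comp; [exact: continuous_borel_measurable2 | exact: measurable_pair1].
  exact: mx.
have -> : (fun x => \int[m2]_y h (x, y)) = (fun x => \1_U x * fine (m2 A)).
  apply/funext => x; under eq_Rintegral do rewrite hE.
  have [Ux|Ux] := pselect (U x); last first.
    rewrite indicE memNset// mul0r; under eq_Rintegral do rewrite mul0r.
    by rewrite /Rintegral integral0.
  rewrite indicE mem_set// mul1r; under eq_Rintegral do rewrite mul1r.
  by rewrite Rintegral_indic ?inv2//; [exact: UV | exact: mtr].
have -> : (fun y => \int[m1]_x h (x, y)) = (fun y => \1_U y * fine (m1 (inv @^-1` A))).
  apply/funext => y; under eq_Rintegral do rewrite hE'.
  have [Uy|Uy] := pselect (U y); last first.
    rewrite indicE memNset// mul0r; under eq_Rintegral do rewrite mul0r.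
    by rewrite /Rintegral integral0.
  rewrite indicE mem_set// mul1r; under eq_Rintegral do rewrite mul1r.
  by rewrite Rintegral_indic ?inv1//; [exact: UV | exact: mtr].
have cU (m : {measure set (borel T) -> \bar R}) (c : R) : (m U < +oo)%E ->
    \int[m]_x (\1_U x * c) = fine (m U) * c.
  move=> oo; have iU : m.-integrable setT (EFin \o (\1_U : borel T -> R)).
    by apply: (@integrable_supported _ _ _ _ (U : set (borel T)) _ 1) => // [x|x Ux];
      [rewrite indicE ger0_norm ?lern1 ?leq_b1
      | rewrite indicE memNset].
  by rewrite (RintegralZr _ measurableT iU) Rintegral_indic.
by rewrite !cU.
Qed.

Lemma haar_inv (m : {measure set (borel T) -> \bar R}) (A : set (borel T)) :
  invariant_under U m -> (m U < +oo)%E -> measurable A -> A `<=` U ->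
  fine (m U) * fine (m (inv @^-1` A)) = fine (m U) * fine (m A).
Proof. by move=> im oo mA AU; rewrite -haar_swap. Qed.

(** The inverse of A is eliminated between [haar_swap] for (m1, m2) and for
    (m1, m1). *)
Lemma haar_unique (m1 m2 : {measure set (borel T) -> \bar R}) (c : R) (A : set (borel T)) :
  invariant_under U m1 -> invariant_under U m2 ->
  (m2 U < +oo)%E -> m1 U = (c%:E * m2 U)%E -> measurable A -> A `<=` U ->
  m1 A = (c%:E * m2 A)%E.
Proof.
move=> inv1 inv2 oo2 mc mA AU; have mU := borel_open oU.
have f2 : m2 U \is a fin_num by rewrite ge0_fin_numE.
have oo1 : (m1 U < +oo)%E by rewrite mc -(fineK f2) -EFinM ltry.
have leU (m : {measure set (borel T) -> \bar R}) : (m A <= m U)%E.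
  by apply: le_measure => //; rewrite inE.
have fA (m : {measure set (borel T) -> \bar R}) : (m U < +oo)%E -> m A \is a fin_num.
  by move=> oo; rewrite ge0_fin_numE// (le_lt_trans (leU m)).
have [m20|m20] := eqVneq (m2 U) 0%E.
  have m10 : m1 U = 0%E by rewrite mc m20 mule0.
  have -> : m1 A = 0%E by apply/eqP; rewrite eq_le measure_ge0 andbT -m10 leU.
  have -> : m2 A = 0%E by apply/eqP; rewrite eq_le measure_ge0 andbT -m20 leU.
  by rewrite mule0.
rewrite -(fineK (fA _ oo1)) -(fineK (fA _ oo2)) -EFinM; congr (_%:E).
have u2 : fine (m2 U) != 0 by rewrite fine_eq0.
apply: (mulfI u2).
have sw := haar_swap inv1 inv2 oo1 oo2 mA AU.
have sw' := haar_inv inv1 oo1 mA AU.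
have m1U : fine (m1 U) = c * fine (m2 U) by rewrite mc fineM.
have [c0|c0] := eqVneq c 0.
  move: (leU m1); rewrite mc c0 mul0e => m1A.
  have -> : m1 A = 0%E by apply/eqP; rewrite eq_le measure_ge0 andbT.
  by rewrite mul0r.
have /(mulfI _) sw2 : fine (m1 U) * fine (m1 (inv @^-1` A)) = fine (m1 U) * fine (m1 A) by [].
by rewrite -sw2 ?m1U ?mulf_neq0// -sw m1U; ring.
Qed.

End OnSubgroup.

(** Continuity from below along the exhausting subgroups. *)
Lemma haar_unique_exhaust (U : nat -> set T)
    (m1 m2 : {measure set (borel T) -> \bar R}) (c : R) (A : set (borel T)) :
  (forall n, open (U n)) ->
  (forall n x y, U n x -> U n y -> U n (op x y)) ->
  (forall n x, U n x -> U n (inv x)) ->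
  nondecreasing_seq U -> \bigcup_n U n = setT ->
  (forall n, invariant_under (U n) m1) -> (forall n, invariant_under (U n) m2) ->
  (forall n, m2 (U n) < +oo)%E -> (forall n, m1 (U n) = (c%:E * m2 (U n))%E) ->
  measurable A -> m1 A = (c%:E * m2 A)%E.
Proof.
move=> oU UM UV ndU bU inv1 inv2 oo mc mA.
have mAU n : measurable (A `&` U n : set (borel T)).
  by apply: measurableI => //; exact: borel_open.
have ndA : nondecreasing_seq (fun n => A `&` U n : set (borel T)).
  by move=> m n mn; apply/subsetPset; apply: setIS; apply/subsetPset; exact: ndU.
have eA : \bigcup_n (A `&` U n) = A by rewrite -setI_bigcupr bU setIT.
have cv (m : {measure set (borel T) -> \bar R}) : m (A `&` U n) @[n --> \oo] --> m A.
  have := @nondecreasing_cvg_mu _ _ _ m _ mAU _ ndA.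
  by rewrite eA; apply.
apply: (cvg_unique _ (cv m1)) => //.
have -> : (fun n => m1 (A `&` U n)) = (fun n => c%:E * m2 (A `&` U n))%E.
  apply/funext => n; apply: (haar_unique (oU n) (UM n) (UV n) (inv1 n) (inv2 n)) => //.
by apply: cvgeZl => //; exact: cv.
Qed.

Lemma pushforward_exists (m : {measure set (borel T) -> \bar R}) (phi : T -> T) :
  continuous phi -> exists m' : {measure set (borel T) -> \bar R},
    forall A, m' A = m (phi @^-1` A).
Proof.
move=> /continuous_borel_measurable mphi.
by exists (measure_function_pushforward__canonical__measure_function_Measure m mphi).
Qed.

(** The pushforward along phi is invariant again, so it is compared with the
    measure itself on the exhausting subgroups. *)
Lemma haar_automorphism (U : nat -> set T) (m : {measure set (borel T) -> \bar R})
    (phi : T -> T) (c : R) (A : set (borel T)) :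
  (forall n, open (U n)) ->
  (forall n x y, U n x -> U n y -> U n (op x y)) ->
  (forall n x, U n x -> U n (inv x)) ->
  nondecreasing_seq U -> \bigcup_n U n = setT ->
  invariant_under setT m -> (forall n, m (U n) < +oo)%E ->
  continuous phi -> {morph phi : x y / op x y} -> (forall h, exists h', phi h' = h) ->
  (forall n, m (phi @^-1` U n) = (c%:E * m (U n))%E) ->
  measurable A -> m (phi @^-1` A) = (c%:E * m A)%E.
Proof.
move=> oU UM UV ndU bU im oo cphi phiM phi_surj mc mA.
have [m' m'E] := pushforward_exists m cphi.
rewrite -m'E; apply: (haar_unique_exhaust oU UM UV ndU bU) => //.
- move=> n h B _ mB; have [h' <-] := phi_surj h.
  rewrite !m'E -(im h' (phi @^-1` B))//.
    by congr (m _); apply/funext => x; rewrite /= phiM.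
  rewrite -[X in measurable X]setTI.
  exact: (continuous_borel_measurable cphi measurableT).
- by move=> n h B _ mB; exact: im.
by move=> n; rewrite m'E.
Qed.

End HaarUniqueness.

(** * Haar measure on the field *)

Section HaarField.
Context {R : realType} {F : padicFieldType R}.
Local Notation pabs := (@pabs R F).
Variable mu : {measure set (borel F) -> \bar R}.
Hypothesis hmu : is_haar (fun x y : F => x + y) setT mu.
Hypothesis hmu1 : mu (pint F) = 1%E.

Lemma mu_pball_fin r : (mu (pball r) < +oo)%E.
Proof. by case: hmu => _ _; apply; exact: compact_pball. Qed.

Lemma measurable_pball r : measurable (pball r : set (borel F)).
Proof. by apply: borel_closed; exact: closed_pball. Qed.

(** A ball is the disjoint union of q translates of the ball whose radius is q
    times smaller, so the mass is proportional to the radius; the induction goes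
    up and down from the ring of integers. *)
Lemma mu_pball (c : F) : c != 0 -> mu (pball (pabs c)) = (pabs c)%:E.
Proof.
have [k [w [rep [w01 [wmax rep1 wq rep_inj repP]]]]] := @residue_system R F.
have /andP[w0 w1] := w01.
have w0' : w != 0 by apply: contraTneq w0 => ->; rewrite pabs0 ltxx.
have step (x : F) : x != 0 ->
    fine (mu (pball (pabs (x * w)))) = pabs w * fine (mu (pball (pabs x))).
  move=> x0; have px := pabs_gt0 x0.
  pose B a : set (borel F) := [set y | pball (pabs (x * w)) (- (x * rep a) + y)].
  have BE a : mu (B a) = mu (pball (pabs (x * w))).
    case: hmu => _ inv _.
    exact: (inv (- (x * rep a)) (pball (pabs (x * w))) I (measurable_pball _)).
  have mB a : measurable (B a).
    apply: borel_closed; have cc : continuous (fun y : F => - (x * rep a) + y).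
      by apply: pcontinuousD; [exact: cst_continuous | move=> y; exact: cvg_id].
    exact: (iffLR (continuous_closedP _) cc _ (@closed_pball R F _)).
  have eB : pball (pabs x) = \bigcup_(a in [set` enum k]) B a.
    apply/seteqP; split=> [y yx|y [a _]]; rewrite /B /pball /=.
      have [|a ya] := repP (y / x).
        by rewrite pabsM pabsV ler_pdivrMr// mul1r.
      exists a; first by rewrite /= mem_enum.
      rewrite /B /pball/=; have -> : - (x * rep a) + y = x * (y / x - rep a).
        by rewrite mulrBr mulrCA divff// mulr1 addrC.
      by rewrite !pabsM ler_pM2l.
    move=> ya; rewrite -[y](addNKr (x * rep a)); apply: pabsD_le.
      by rewrite pabsM ler_piMr ?pabs_ge0.
    by rewrite (le_trans ya)// pabsM ler_piMr ?pabs_ge0 ?ltW.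
  have tB : trivIset [set` enum k] B.
    move=> a b _ _ [y [ya yb]]; apply: rep_inj.
    have -> : rep a - rep b = ((- (x * rep b) + y) - (- (x * rep a) + y)) / x.
      by field.
    rewrite pabsM pabsV ltr_pdivrMr// mul1r.
    apply: (@le_lt_trans _ _ (pabs (x * w))); first exact: pabsB_le.
    by rewrite pabsM gtr_pMr.
  rewrite eB measure_fin_bigcup//.
  rewrite -fsbig_seq ?enum_uniq//.
  rewrite (eq_bigr (fun=> (fine (mu (pball (pabs (x * w)))))%:E)); last first.
    by move=> a _; rewrite fineK ?ge0_fin_numE ?mu_pball_fin//; exact: BE.
  rewrite sumEFin big_const_seq count_predT iter_addr_0 -cardE /= wq.
  rewrite -[X in _ = _ * X]mulr_natl mulrA mulVf ?mul1r// pnatr_eq0 -lt0n.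
  by have [|a _] := repP 0; [rewrite pabs0 ler01 | apply/card_gt0P; exists a].
have X (x : F) n : x != 0 -> fine (mu (pball (pabs x))) = pabs x ->
    fine (mu (pball (pabs (x * w ^+ n)))) = pabs (x * w ^+ n).
  move=> x0 xE; elim: n => [|n IH]; first by rewrite expr0 mulr1.
  by rewrite exprSr mulrA step ?mulf_neq0 ?expf_neq0// IH !pabsM mulrC.
have mu1 : fine (mu (pball (pabs 1))) = pabs 1 by rewrite pabs1 [mu _]hmu1.
have Y n : fine (mu (pball (pabs (w ^- n)))) = pabs (w ^- n).
  elim: n => [|n IH]; first by rewrite expr0 invr1.
  apply: (mulfI (lt0r_neq0 w0)).
  rewrite -step ?invr_eq0 ?expf_neq0// -pabsM.
  have -> : w ^- n.+1 * w = w ^- n by rewrite exprS invfM mulrAC mulVf ?mul1r.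
  by rewrite IH mulrC exprS invfM mulrAC mulVf ?mul1r.
move=> c0; rewrite -[LHS]fineK ?ge0_fin_numE ?mu_pball_fin//; congr (_%:E).
have [n [] cE] := pabs_value_group w01 wmax c0.
  by have := X 1 n (oner_neq0 _) mu1; rewrite mul1r pabsX cE.
by have := Y n; rewrite pabsV pabsX cE.
Qed.

Lemma pball_exhaust : exists U : nat -> F,
  [/\ forall n, U n != 0, nondecreasing_seq (fun n => @pball R F (pabs (U n))) &
      \bigcup_n @pball R F (pabs (U n)) = setT].
Proof.
have [w /andP[w0 w1]] := @pabs_uniformizer R F.
have w0' : w != 0 by apply: contraTneq w0 => ->; rewrite pabs0 ltxx.
exists (fun n => w ^- n); split=> [n|m n mn|].
- by rewrite invr_eq0 expf_neq0.
- apply/subsetPset => x /= xm; apply: le_trans xm _.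
  by rewrite !pabsV !pabsX lef_pV2 ?posrE ?exprn_gt0// ler_wiXn2l// ltW.
apply/seteqP; split=> // x _.
have [->|x0] := eqVneq x 0; first by exists 0 => //; rewrite /pball /= pabs0 pabs_ge0.
have px : 0 < (pabs x)^-1 by rewrite invr_gt0 pabs_gt0.
have /cvgrPdist_lt/(_ _ px)[N _ /(_ N (leqnn N))] :
    pabs w ^+ n @[n --> \oo] --> (0 : R).
  by apply: cvg_expr; rewrite ger0_norm ?ltW.
rewrite /= sub0r normrN ger0_norm ?exprn_ge0 ?ltW// => wr; exists N => //.
rewrite /pball/= pabsV pabsX -[leLHS]invrK lef_pV2 ?posrE ?exprn_gt0// ?ltW//.
Qed.

(** The preimage of a ball is a ball, so [haar_automorphism] applies. *)
Lemma mu_scale (c : F) (A : set (borel F)) : c != 0 -> measurable A ->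
  mu ((fun x => c * x) @^-1` A) = ((pabs c)^-1%:E * mu A)%E.
Proof.
move=> c0; have [u [u0 ndu bu]] := pball_exhaust; case: (hmu) => _ inv oo.
apply: (@haar_automorphism R F (fun x y => x + y) (fun x => - x) _ _ _ _ _ _
  (fun n => pball (pabs (u n)))) => //.
- exact: second_countable_padic.
- by move=> x y; rewrite addKr.
- by move=> x y; rewrite addNKr.
- by move=> x y; rewrite opprD opprK addrC.
- by apply: pcontinuousN => y; exact: cvg_id.
- by apply: pcontinuousD; [apply: pcontinuousN => z; exact: cvg_fst | move=> z; exact: cvg_snd].
- by move=> n; apply: open_pball; rewrite pabs_gt0.
- by move=> n x y; exact: pabsD_le.
- by move=> n x; rewrite /pball/= pabsN.
- by move=> n; exact: mu_pball_fin.
- by apply: pcontinuousM; [exact: cst_continuous | move=> y; exact: cvg_id].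
- by move=> x y; rewrite mulrDr.
- by move=> h; exists (c^-1 * h); rewrite mulrA divff ?mul1r.
move=> n.
have -> : (fun x => c * x) @^-1` pball (pabs (u n)) = pball (pabs (u n / c)).
  by apply/seteqP; split=> x; rewrite /pball /= !pabsM pabsV ler_pdivlMr ?pabs_gt0// mulrC.
by rewrite !mu_pball ?mulf_neq0 ?invr_eq0// -EFinM pabsM pabsV mulrC.
Qed.

Lemma measurable_point (x : F) : measurable ([set x] : set (borel F)).
Proof.
apply: borel_closed; apply: accessible_closed_set1.
exact/hausdorff_accessible/metric_hausdorff.
Qed.

Lemma mu_point0 : mu [set 0] = 0%E.
Proof.
apply/eqP; rewrite eq_le measure_ge0 andbT; apply/lee_addgt0Pr => e e0.
rewrite add0e; have [c c0 ce] := @pabs_small R F e e0.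
apply: (@le_trans _ _ (mu (pball (pabs c)))); last by rewrite mu_pball// lee_fin ltW.
apply: le_measure; rewrite ?inE; [exact: measurable_point| exact: measurable_pball|].
by move=> _ ->; rewrite /pball/= pabs0 pabs_ge0.
Qed.

End HaarField.

(** * Real and imaginary parts *)

Section ComplexParts.
Context {R : realType}.

Lemma complexReM (x y : R[i]) : complex.Re (x * y) =
  complex.Re x * complex.Re y - complex.Im x * complex.Im y.
Proof. by case: x => a b; case: y. Qed.

Lemma complexImM (x y : R[i]) : complex.Im (x * y) =
  complex.Re x * complex.Im y + complex.Im x * complex.Re y.
Proof. by case: x => a b; case: y. Qed.

Lemma Re_continuous : continuous (@complex.Re R : R[i]^o -> R).
Proof.
move=> z; apply/(@cvgrPdist_lt _ _ _ (nbhs z) (nbhs_filter z)) => e e0.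
have e0' : 0 < e%:C :> R[i] by rewrite ltcR.
have := @nbhsx_ballx _ (R[i]^o) z _ e0'.
move=> zb; near=> w; have zw : `|z - w| < e%:C by near: w; exact: zb.
have h := normc_ge_Re (z - w); rewrite -ltcR; apply: le_lt_trans zw.
by move: h; rewrite raddfB.
Unshelve. all: by end_near. Qed.

Lemma norm_ge_Im (z : R[i]) : `|complex.Im z|%:C <= `|z|.
Proof.
case: z => a b; rewrite lecR /=.
by rewrite -sqrtr_sqr ler_wsqrtr// lerDr sqr_ge0.
Qed.

Lemma Im_continuous : continuous (@complex.Im R : R[i]^o -> R).
Proof.
move=> z; apply/(@cvgrPdist_lt _ _ _ (nbhs z) (nbhs_filter z)) => e e0.
have e0' : 0 < e%:C :> R[i] by rewrite ltcR.
have := @nbhsx_ballx _ (R[i]^o) z _ e0'.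
move=> zb; near=> w; have zw : `|z - w| < e%:C by near: w; exact: zb.
have h := norm_ge_Im (z - w); rewrite -ltcR; apply: le_lt_trans zw.
by move: h; rewrite raddfB.
Unshelve. all: by end_near. Qed.

Lemma locally_constant_continuous (T S : topologicalType) (f : T -> S) :
  locally_constant f -> continuous f.
Proof.
move=> lf x A fxA; apply: filterS (lf x) => y fy.
by rewrite /preimage/= fy; exact: nbhs_singleton.
Qed.

End ComplexParts.

(** * The Killing form and the adjoint action *)

Section Killing.
Context {R : realType} {F : padicFieldType R}.
Local Notation pabs := (@pabs R F).
Implicit Types (X Y : sl2 F) (k : SL2 F).

Lemma sl2_11 X : X 1 1 = - X 0 0.
Proof.
have := valP X; rewrite unfold_in [\tr _](_ : _ = X 0 0 + X 1 1).
  by rewrite addrC addr_eq0 => /eqP.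
rewrite /mxtrace big_ord_recl big_ord1; congr (_ + X _ _); exact: val_inj.
Qed.

Lemma sl2_eta X : X = sl2_mx (X 0 0) (X 0 1) (X 1 0).
Proof. by apply: val_inj; rewrite /= -sl2_11 -mx2_eta. Qed.

Lemma mx2B (a b c d a' b' c' d' : F) :
  mx2 a b c d - mx2 a' b' c' d' = mx2 (a - a') (b - b') (c - c') (d - d').
Proof.
by apply/matrixP=> i j; rewrite !mxE; case: i j => [[|[|//]] ?] [[|[|//]] ?].
Qed.

Lemma killingE X Y :
  killing X Y = 8 * (X 0 0 * Y 0 0) + 4 * (X 0 1 * Y 1 0 + X 1 0 * Y 0 1).
Proof.
rewrite [X]sl2_eta [Y]sl2_eta /killing /bracket /= !mx2M !mx2B !mx2M !mx2B.
by rewrite !mxE /=; ring.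
Qed.

Lemma killing_trace X Y : killing X Y = 4 * \tr ((X : 'M[F]_2) * (Y : 'M[F]_2)).
Proof.
rewrite killingE [in RHS](sl2_eta X) [in RHS](sl2_eta Y) /= mx2M.
by rewrite /mxtrace big_ord_recl big_ord1 !mxE /=; ring.
Qed.

Lemma killing_adj k X Y : killing (adj k X) (adj k Y) = killing X Y.
Proof.
rewrite !killing_trace; congr (_ * _) => /=.
rewrite [X in \tr X](_ : _ =
  (k : 'M[F]_2)^-1 * ((X : 'M[F]_2) * (Y : 'M[F]_2)) * (k : 'M[F]_2)).
  by rewrite mxtrace_mulC [_ *m _]mulrA mulrV ?SL2_unit// mul1r.
rewrite -!mulrA; congr (_ * (_ * _)).
by rewrite [(k : 'M[F]_2) * _]mulrA mulrV ?SL2_unit// mul1r.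
Qed.

Lemma adjM k h X : adj (k * h)%g X = adj h (adj k X).
Proof.
apply: val_inj; rewrite /= invrM ?SL2_unit//.
by rewrite !mulrA.
Qed.

Lemma adj1 X : adj 1%g X = X.
Proof. by apply: val_inj; rewrite /= invr1 mul1r mulr1. Qed.

Lemma adjD k X Y : adj k (X + Y) = adj k X + adj k Y.
Proof. by apply: val_inj; rewrite /= mulrDr mulrDl. Qed.

Lemma adjB k X Y : adj k (X - Y) = adj k X - adj k Y.
Proof. by apply: val_inj; rewrite /= mulrBr mulrBl. Qed.

Lemma adjK k X : adj k^-1%g (adj k X) = X.
Proof. by rewrite -adjM mulgV adj1. Qed.

Lemma adjVK k X : adj k (adj k^-1%g X) = X.
Proof. by rewrite -adjM mulVg adj1. Qed.

Lemma SL2intM k h : SL2int F k -> SL2int F h -> SL2int F (k * h)%g.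
Proof.
move=> Kk Kh i j; rewrite /pint/= mxE big_ord_recl big_ord1.
by apply: pabsD_le; rewrite pabsM mulr_ile1 ?pabs_ge0//;
  [exact: Kk | exact: Kh | exact: Kk | exact: Kh].
Qed.

Lemma SL2intV k : SL2int F k -> SL2int F k^-1%g.
Proof.
move=> Kk; rewrite /SL2int /pint /= SL2_invE; apply: forall_mx2;
  by rewrite mxE /= ?pabsN; exact: Kk.
Qed.

Lemma mulmx_bound (A B : 'M[F]_2) (r s : R) :
  (forall i j, pabs (A i j) <= r) -> (forall i j, pabs (B i j) <= s) ->
  forall i j, pabs ((A * B) i j) <= r * s.
Proof.
move=> Ar Bs i j; rewrite mxE big_ord_recl big_ord1.
by apply: pabsD_le; rewrite pabsM ler_pM ?pabs_ge0.
Qed.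

Lemma adj_ball k r X : SL2int F k -> sl2_ball r X -> sl2_ball r (adj k X).
Proof.
move=> Kk Xr; rewrite /sl2_ball /= -[r]mul1r -[1 * r]mulr1.
apply: mulmx_bound => //; apply: mulmx_bound => //.
exact: (SL2intV Kk).
Qed.

End Killing.

(** * Complex integrals *)

Section ComplexIntegral.
Context {R : realType}.

Lemma complex_eq (z w : R[i]) : complex.Re z = complex.Re w ->
  complex.Im z = complex.Im w -> z = w.
Proof. by case: z => a b; case: w => c d /= -> ->. Qed.

Lemma complexReZ (a : R) (z : R[i]) : complex.Re (a%:C * z) = a * complex.Re z.
Proof. by rewrite complexReM /= mul0r subr0. Qed.

Lemma complexImZ (a : R) (z : R[i]) : complex.Im (a%:C * z) = a * complex.Im z.
Proof. by rewrite complexImM /= mul0r addr0. Qed.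

Definition cmeasurable d (T : measurableType d) (f : T -> R[i]) :=
  measurable_fun setT (fun x => complex.Re (f x)) /\
  measurable_fun setT (fun x => complex.Im (f x)).

Definition cbounded (T : Type) (f : T -> R[i]) (M : R) :=
  forall x, `|complex.Re (f x)| <= M /\ `|complex.Im (f x)| <= M.

Lemma cintegral_mkcond d (T : measurableType d) (m : {measure set T -> \bar R})
    (D : set T) (f : T -> R[i]) :
  cintegral m D f = cintegral m setT (fun x => (\1_D x)%:C * f x).
Proof.
have E (g : T -> R) : g \_ D = (fun x => \1_D x * g x).
  apply/funext => x; rewrite patchE indicE; case: ifPn => xD; first by rewrite mul1r.
  by rewrite mul0r.
by apply: complex_eq; rewrite /= Rintegral_mkcond E; apply: eq_Rintegral => x _;
  rewrite ?complexReZ ?complexImZ.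
Qed.

Lemma eq_cintegral d (T : measurableType d) (m : {measure set T -> \bar R})
    (D : set T) (f g : T -> R[i]) : (forall x, D x -> f x = g x) ->
  cintegral m D f = cintegral m D g.
Proof.
by move=> fg; apply: complex_eq; apply: eq_Rintegral => x; rewrite inE => /fg ->.
Qed.

Lemma cintegral_swap d1 d2 (T1 : measurableType d1) (T2 : measurableType d2)
    (m1 : {measure set T1 -> \bar R}) (m2 : {measure set T2 -> \bar R})
    (D1 : set T1) (D2 : set T2) (h : T1 * T2 -> R[i]) (M : R) :
  measurable D1 -> measurable D2 -> (m1 D1 < +oo)%E -> (m2 D2 < +oo)%E ->
  cmeasurable h -> cbounded h M ->
  (forall x y, ~ (D1 x /\ D2 y) -> h (x, y) = 0) ->
  cintegral m1 setT (fun x => cintegral m2 setT (fun y => h (x, y))) =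
  cintegral m2 setT (fun y => cintegral m1 setT (fun x => h (x, y))).
Proof.
move=> mD1 mD2 oo1 oo2 [mr mi] hM h0; apply: complex_eq => /=.
  apply: (Rintegral_swap mD1 mD2 oo1 oo2 mr (M := M)) => [z|x y nD].
    by have [] := hM z.
  by rewrite h0.
apply: (Rintegral_swap mD1 mD2 oo1 oo2 mi (M := M)) => [z|x y nD].
  by have [] := hM z.
by rewrite h0.
Qed.

Lemma cintegralZr d (T : measurableType d) (m : {measure set T -> \bar R})
    (D : set T) (f : T -> R[i]) (M : R) (z : R[i]) :
  measurable D -> (m D < +oo)%E -> cmeasurable f -> cbounded f M ->
  (forall x, ~ D x -> f x = 0) ->
  cintegral m setT (fun x => f x * z) = cintegral m setT f * z.
Proof.
move=> mD oo [mr mi] fM f0.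
have ir : m.-integrable setT (EFin \o (fun x => complex.Re (f x))).
  by apply: (@integrable_supported _ _ _ _ D _ M) => // x; [have [] := fM x | move/f0 ->].
have ii : m.-integrable setT (EFin \o (fun x => complex.Im (f x))).
  by apply: (@integrable_supported _ _ _ _ D _ M) => // x; [have [] := fM x | move/f0 ->].
have iZ (g : T -> R) (c : R) : m.-integrable setT (EFin \o g) ->
    m.-integrable setT (EFin \o (fun x => g x * c)).
  by move=> ig; have := @integrableZr _ _ _ m setT measurableT c _ ig; apply.
apply: complex_eq; rewrite ?complexReM ?complexImM /=.
  under eq_Rintegral do rewrite complexReM.
  by rewrite RintegralB ?RintegralZr//; exact: iZ.
under eq_Rintegral do rewrite complexImM.
by rewrite RintegralD ?RintegralZr//; exact: iZ.
Qed.

Definition ccontinuous (S : topologicalType) (f : S -> R[i]) :=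
  continuous (fun x => complex.Re (f x)) /\ continuous (fun x => complex.Im (f x)).

Lemma ccontinuousM (S : topologicalType) (f g : S -> R[i]) :
  ccontinuous f -> ccontinuous g -> ccontinuous (fun x => f x * g x).
Proof.
move=> [fr fi] [gr gi]; split.
  rewrite (eq_fun (fun x => complexReM (f x) (g x))) => x.
  by apply: cvgB; apply: cvgM; [exact: fr|exact: gr|exact: fi|exact: gi].
rewrite (eq_fun (fun x => complexImM (f x) (g x))) => x.
by apply: cvgD; apply: cvgM; [exact: fr|exact: gi|exact: fi|exact: gr].
Qed.

Lemma ccontinuous_comp (S : topologicalType) (T : topologicalType)
    (f : T -> R[i]) (g : S -> T) :
  ccontinuous f -> continuous g -> ccontinuous (fun x => f (g x)).
Proof.
by move=> [fr fi] cg; split=> x; [apply: (@continuous_comp _ _ _ g (fun y => complex.Re (f y)))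
  | apply: (@continuous_comp _ _ _ g (fun y => complex.Im (f y)))];
  [exact: cg | exact: fr | exact: cg | exact: fi].
Qed.

Lemma ccontinuous_lc (T : topologicalType) (f : T -> R[i]) :
  locally_constant f -> ccontinuous f.
Proof.
move=> lf; split; apply: locally_constant_continuous => x;
  by apply: filterS (lf x) => y ->.
Qed.

Lemma ccontinuous_measurable (T : ptopologicalType) (f : T -> R[i]) :
  ccontinuous f -> cmeasurable (f : borel T -> R[i]).
Proof. by move=> [fr fi]; split; exact: continuous_real_measurable. Qed.

Lemma ccontinuous_measurable2 (T1 T2 : ptopologicalType) (f : T1 * T2 -> R[i]) :
  @second_countable T1 -> @second_countable T2 ->
  ccontinuous f -> cmeasurable (f : (borel T1 * borel T2)%type -> R[i]).
Proof. by move=> s1 s2 [fr fi]; split; exact: continuous_real_measurable2. Qed.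

Lemma cbounded_norm1 (T : Type) (f : T -> R[i]) :
  (forall x, `|f x| = 1) -> cbounded f 1.
Proof.
by move=> f1 x; rewrite -!lecR [1%:C](_ : _ = `|f x|) ?f1// -(f1 x) normc_ge_Re norm_ge_Im.
Qed.

Lemma cboundedM (T : Type) (f g : T -> R[i]) (M N : R) :
  cbounded f M -> cbounded g N -> cbounded (fun x => f x * g x) (M * N + M * N).
Proof.
move=> fM gN x; have [fr fi] := fM x; have [gr gi] := gN x.
rewrite complexReM complexImM; split.
  by rewrite (le_trans (ler_normB _ _))// !normrM lerD// ler_pM.
by rewrite (le_trans (ler_normD _ _))// !normrM lerD// ler_pM.
Qed.

End ComplexIntegral.

(** * Test functions and Haar measure on the Lie algebra *)

Section TestFunctions.
Context {R : realType} {F : padicFieldType R}.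
Local Notation pabs := (@pabs R F).

(** The uniform form of being locally constant with compact support: f is
    invariant under a lattice and supported in a ball.  In this form it is
    visibly inherited by the K-average. *)
Definition test_function (f : sl2 F -> R[i]) :=
  (exists2 e : R, 0 < e & forall X Y, sl2_ball e (X - Y) -> f X = f Y) /\
  (exists r : R, forall X, f X <> 0 -> sl2_ball r X).

Lemma near_sl2_ball (e : R) (X : sl2 F) : 0 < e -> \forall Y \near X, sl2_ball e (X - Y).
Proof.
move=> e0; apply: filterS (near_coord coordinates_sl2 X e0) => Y XY i j.
by rewrite /= !mxE; exact: ltW (XY (i, j)).
Qed.

Lemma sl2_ballB r (X Y : sl2 F) : sl2_ball r X -> sl2_ball r Y -> sl2_ball r (X - Y).
Proof. by move=> Xr Yr i j; rewrite /= !mxE pabsB_le. Qed.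

Lemma sl2_ballD r (X Y : sl2 F) : sl2_ball r X -> sl2_ball r Y -> sl2_ball r (X + Y).
Proof. by move=> Xr Yr i j; rewrite /= !mxE pabsD_le. Qed.

Lemma sl2_ballN r (X : sl2 F) : sl2_ball r X -> sl2_ball r (- X).
Proof. by move=> Xr i j; rewrite /= !mxE pabsN. Qed.

Lemma sl2_ballW r s (X : sl2 F) : r <= s -> sl2_ball r X -> sl2_ball s X.
Proof. by move=> rs Xr i j; exact: le_trans (Xr i j) rs. Qed.

Lemma sl2_bounded (X : sl2 F) : exists n : nat, sl2_ball n%:R X.
Proof.
pose n := (\max_(ij : 'I_2 * 'I_2) (Num.truncn (pabs (X ij.1 ij.2))).+1)%N.
exists n => i j; rewrite (le_trans (ltW (truncnS_gt _)))// ler_nat.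
exact: (leq_bigmax (F := fun ij => (Num.truncn (pabs (X ij.1 ij.2))).+1) (i, j)).
Qed.

Lemma test_functionP (f : sl2 F -> R[i]) :
  locally_constant f -> compactly_supported f -> test_function f.
Proof.
move=> lf cf; have ncov := iffLR (compact_near_coveringP _) cf.
have S0 X : f X <> 0 -> closure [set Y | f Y != 0] X.
  by move=> /eqP fX; exact: subset_closure.
split; last first.
  have [|N _ NP] := ncov nat \oo (fun n X => sl2_ball n%:R X) _.
    move=> X _; have [n Xn] := sl2_bounded X.
    exists ([set Y | sl2_ball 1 (X - Y)], [set m | (n.+1 <= m)%N]).
      by split; [exact: near_sl2_ball | exists n.+1].
    move=> [Y m] [/= XY nm]; rewrite -[Y](subKr X); apply: sl2_ballB.
      by apply: sl2_ballW Xn; rewrite ler_nat ltnW.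
    by apply: sl2_ballW XY; rewrite ler1n (leq_trans _ nm).
  by exists N%:R => X /S0; exact: (NP N (leqnn N)).
have ne : \forall e \near 0^'+, closure [set Y | f Y != 0] `<=`
    (fun X => forall Y, sl2_ball (e : R) (X - Y) -> f X = f Y).
  apply: (ncov R 0^'+ (fun e X => forall Y, sl2_ball e (X - Y) -> f X = f Y)).
  move=> X _; have /coordinates_sl2[d d0 dP] := lf X.
  (* Non-strict balls of radius d / 2 stay inside the strict box of size d. *)
  exists ([set Y | sl2_ball (d / 2) (X - Y)], [set e : R | e < d / 2]).
    by split; [apply: near_sl2_ball; rewrite divr_gt0 | exact: nbhs_right_lt (divr_gt0 _ _)].
  have dd : d / 2 < d by rewrite ltr_pdivrMr// ltr_pMr// ltr1n.
  move=> [Y e] [/= XY ed] Z YZ; rewrite (dP Y) ?(dP Z)//= => -[i j].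
    have -> : X i j - Z i j = (X - Y) i j + (Y - Z) i j.
      by rewrite /= !mxE addrA subrK.
    by rewrite (le_lt_trans _ dd)// pabsD_le// (le_trans (YZ _ _))// ltW.
  by rewrite (le_lt_trans _ dd)//; have := XY i j; rewrite /= !mxE.
case: ne => d /= d0 dP; pose e := d / 2.
have e0 : 0 < e by rewrite divr_gt0.
have eP := dP e _ e0; rewrite /= sub0r normrN gtr0_norm// in eP.
have ed : e < d by rewrite ltr_pdivrMr// ltr_pMr// ltr1n.
have {}eP := eP ed.
exists e => // X Y XY; have [fX|/eqP fX] := eqVneq (f X) 0; last exact: eP (S0 _ fX) _ XY.
apply/esym; have [->//|/eqP fY] := eqVneq (f Y) 0; apply: eP (S0 _ fY) _ _.
by rewrite -opprB; exact: sl2_ballN.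
Qed.

Lemma test_locally_constant (f : sl2 F -> R[i]) :
  test_function f -> locally_constant f.
Proof.
by move=> [[e e0 eP] _] X; apply: filterS (near_sl2_ball X e0) => Y /eP.
Qed.

Lemma test_compactly_supported (f : sl2 F -> R[i]) :
  test_function f -> compactly_supported f.
Proof.
move=> [_ [r rP]]; apply: (subclosed_compact _ (@compact_sl2_ball R F r)).
  exact: closed_closure.
rewrite closureE; apply: smallest_sub; first exact: closed_sl2_ball.
by move=> X /eqP; exact: rP.
Qed.

Lemma test_bounded (f : sl2 F -> R[i]) : test_function f -> exists M, cbounded f M.
Proof.
move=> tf; have cf := test_compactly_supported tf.
have ncov := iffLR (compact_near_coveringP _) cf.
have [|N _ NP] := ncov nat \oo
  (fun n X => `|complex.Re (f X)| <= n%:R /\ `|complex.Im (f X)| <= n%:R) _.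
  move=> X _; pose n :=
    maxn (Num.truncn `|complex.Re (f X)|).+1 (Num.truncn `|complex.Im (f X)|).+1.
  exists ([set Y | f Y = f X], [set m | (n <= m)%N]).
    by split; [exact: test_locally_constant | exists n].
  move=> [Y m] [/= -> nm]; split.
    by rewrite (le_trans (ltW (truncnS_gt _)))// ler_nat (leq_trans _ nm)// leq_maxl.
  by rewrite (le_trans (ltW (truncnS_gt _)))// ler_nat (leq_trans _ nm)// leq_maxr.
exists N%:R => X; have [->|fX] := eqVneq (f X) 0; first by rewrite normr0 ler0n.
by apply: (NP N (leqnn N)); exact: subset_closure.
Qed.

Lemma test_comp (f : sl2 F -> R[i]) (phi : sl2 F -> sl2 F) :
  {morph phi : X Y / X - Y} -> (forall r X, sl2_ball r (phi X) <-> sl2_ball r X) ->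
  test_function f -> test_function (fun X => f (phi X)).
Proof.
move=> phiB phib [[e e0 eP] [r rP]]; split.
  by exists e => // X Y XY; apply: eP; rewrite -phiB; apply/phib.
by exists r => X /rP /phib.
Qed.

Lemma sl2_ball_adj k r (X : sl2 F) : SL2int F k -> sl2_ball r (adj k X) <-> sl2_ball r X.
Proof.
move=> Kk; split=> [Xr|]; last exact: adj_ball.
by rewrite -(adjK k X); apply: adj_ball => //; exact: SL2intV.
Qed.

(** The Killing form pairs the diagonal with the coordinate h and the upper
    nilpotent line with the coordinate c; (h, b, c) |-> (b, c, h) moves the
    first to the second. *)
Definition rotate (X : sl2 F) : sl2 F := sl2_mx (X 0 1) (X 1 0) (X 0 0).

Lemma sl2_ballP r (X : sl2 F) :
  sl2_ball r X <-> [/\ pabs (X 0 0) <= r, pabs (X 0 1) <= r & pabs (X 1 0) <= r].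
Proof.
split=> [Xr|[a b c]]; first by split; exact: Xr.
by apply: forall_mx2 => //; rewrite sl2_11 pabsN.
Qed.

Lemma sl2_ball_rotate r (X : sl2 F) : sl2_ball r (rotate X) <-> sl2_ball r X.
Proof. by split=> /sl2_ballP; rewrite ?mxE /= => -[a b c]; apply/sl2_ballP; rewrite ?mxE. Qed.

Lemma rotateD : {morph rotate : X Y / X + Y}.
Proof. by move=> X Y; rewrite [RHS]sl2_eta /rotate /= !mxE. Qed.

Lemma rotateB : {morph rotate : X Y / X - Y}.
Proof. by move=> X Y; rewrite [RHS]sl2_eta /rotate /= !mxE. Qed.

Lemma sl2_coord_continuous i j : continuous (fun X : sl2 F => X i j).
Proof. exact: (coord_continuous coordinates_sl2 (i := (i, j))). Qed.

Lemma rotate_continuous : continuous rotate.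
Proof. by apply: continuous_sl2_mx; exact: sl2_coord_continuous. Qed.

Lemma adj_continuous k : continuous (@adj R F k).
Proof. by apply: continuous_adj; [exact: cst_continuous | move=> X; exact: cvg_id]. Qed.

Section HaarSl2.
Variable mug : {measure set (borel (sl2 F)) -> \bar R}.
Hypothesis hmug : is_haar (fun X Y : sl2 F => X + Y) setT mug.

Lemma mug_ball_fin r : (mug (sl2_ball r) < +oo)%E.
Proof. by case: hmug => _ _; apply; exact: compact_sl2_ball. Qed.

Lemma measurable_sl2_ball r : measurable (sl2_ball r : set (borel (sl2 F))).
Proof. by apply: borel_closed; exact: closed_sl2_ball. Qed.

(** For [adj k] with k in K and for [rotate], which preserve all lattice balls. *)
Lemma mug_preserved (phi : sl2 F -> sl2 F) (A : set (borel (sl2 F))) :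
  continuous phi -> {morph phi : X Y / X + Y} -> (forall Y, exists X, phi X = Y) ->
  (forall r X, sl2_ball r (phi X) <-> sl2_ball r X) -> measurable A ->
  mug (phi @^-1` A) = mug A.
Proof.
move=> cphi phiD phi_surj phib mA; rewrite -[RHS]mul1e.
case: (hmug) => _ inv oo.
apply: (@haar_automorphism R (sl2 F) (fun x y => x + y) (fun x => - x) _ _ _ _ _ _
  (* The radii start at 1 because only balls of positive radius are open. *)
  (fun n => sl2_ball n.+1%:R)) => //.
- exact: second_countable_sl2.
- by move=> x y; rewrite addKr.
- by move=> x y; rewrite addNKr.
- by move=> x y; rewrite opprD opprK addrC.
- by apply: continuousNsl2 => y; exact: cvg_id.
- by apply: continuousDsl2; [apply: continuousNsl2 => z; exact: cvg_fst | move=> z; exact: cvg_snd].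
- by move=> n; exact: open_sl2_ball.
- by move=> n x y; exact: sl2_ballD.
- by move=> n x; exact: sl2_ballN.
- by move=> m n mn; apply/subsetPset => X; apply: sl2_ballW; rewrite ler_nat.
- apply/seteqP; split=> // X _; have [n Xn] := sl2_bounded X.
  by exists n => //; apply: sl2_ballW Xn; rewrite ler_nat.
- by move=> n; exact: mug_ball_fin.
move=> n; rewrite mul1e; congr (mug _).
by apply/seteqP; split=> X /phib.
Qed.

Lemma mug_change (phi : sl2 F -> sl2 F) (g : sl2 F -> R[i]) :
  continuous phi -> {morph phi : X Y / X + Y} -> (forall Y, exists X, phi X = Y) ->
  (forall r X, sl2_ball r (phi X) <-> sl2_ball r X) -> ccontinuous g ->
  cintegral mug setT (fun X => g (phi X)) = cintegral mug setT g.
Proof.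
move=> cphi phiD phi_surj phib /ccontinuous_measurable[gr gi].
have ch (h : borel (sl2 F) -> R) : measurable_fun setT h ->
    \int[mug]_X h (phi X) = \int[mug]_X h X.
  move=> mh; rewrite -[RHS]mul1r; apply: Rintegral_change => //.
    exact: continuous_borel_measurable.
  by move=> A mA; rewrite mul1e; exact: mug_preserved.
by apply: complex_eq; [exact: ch gr | exact: ch gi].
Qed.

End HaarSl2.


End TestFunctions.

(** * The integral of the Fourier transform over the nilpotent line *)

Section FourierSide.
Context {R : realType} {F : padicFieldType R}.
Local Notation pabs := (@pabs R F).
Variables (mu : {measure set (borel F) -> \bar R}) (psi : F -> R[i])
  (mug : {measure set (borel (sl2 F)) -> \bar R})
  (muK : {measure set (borel (SL2 F)) -> \bar R}).
Hypothesis hpsi : additive_character psi.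
Hypothesis hmug : is_haar (fun X Y : sl2 F => X + Y) setT mug.
Hypothesis hmuK1 : muK (SL2int F) = 1%E.

Lemma cintegral0 d (T : measurableType d) (m : {measure set T -> \bar R}) (D : set T) :
  cintegral m D (fun=> 0) = 0.
Proof. by apply: complex_eq; rewrite /= /Rintegral integral0. Qed.

Lemma measurable_SL2int : measurable (SL2int F : set (borel (SL2 F))).
Proof. by apply: borel_closed; rewrite SL2intE; exact: closed_SL2_ball. Qed.

Lemma SL2int_indic_continuous : ccontinuous (fun k : SL2 F => (\1_(SL2int F) k)%:C : R[i]).
Proof.
apply: ccontinuous_lc => k; have [Kk|Kk] := pselect (SL2int F k).
  have : \forall h \near k, SL2int F h.
    by apply: open_nbhs_nbhs; split=> //; rewrite SL2intE; exact: open_SL2_ball.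
  by apply: filterS => h Kh; rewrite !indicE !mem_set.
have : \forall h \near k, ~ SL2int F h.
  apply: open_nbhs_nbhs; split=> //; apply: closed_openC.
  by rewrite SL2intE; exact: closed_SL2_ball.
by apply: filterS => h Kh; rewrite !indicE !memNset.
Qed.

Lemma test_Kaverage (f : sl2 F -> R[i]) : test_function f -> test_function (Kaverage muK f).
Proof.
move=> [[e e0 eP] [r rP]]; split.
  exists e => // X Y XY; apply: eq_cintegral => k Kk; apply: eP.
  by rewrite -adjB; exact: adj_ball.
exists r => X fX; apply: contrapT => nX; apply: fX.
rewrite -[RHS](cintegral0 muK (SL2int F)); apply: eq_cintegral => k Kk.
by apply: contra_notP nX => /rP/(sl2_ball_adj r X Kk).
Qed.

Lemma killing_continuous (S : topologicalType) (X Y : S -> sl2 F) :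
  continuous X -> continuous Y -> continuous (fun s => killing (X s) (Y s)).
Proof.
move=> /continuous_sl2P cX /continuous_sl2P cY.
rewrite (eq_fun (fun s => killingE (X s) (Y s))).
apply: pcontinuousD; apply: pcontinuousM; try exact: cst_continuous.
  by apply: pcontinuousM; [exact: cX | exact: cY].
by apply: pcontinuousD; apply: pcontinuousM; [exact: cX | exact: cY | exact: cX | exact: cY].
Qed.

Lemma psi_continuous (S : topologicalType) (x : S -> F) :
  continuous x -> ccontinuous (fun s => psi (x s)).
Proof.
move=> cx; apply: (ccontinuous_comp (f := psi) _ cx).
case: hpsi => cpsi _ _; split=> y.
  exact: (@continuous_comp _ _ _ (psi : F -> R[i]^o) (@complex.Re R) y
    (cpsi y) (@Re_continuous R _)).
exact: (@continuous_comp _ _ _ (psi : F -> R[i]^o) (@complex.Im R) y (cpsi y) (@Im_continuous R _)).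
Qed.

(** Both the measure and the Killing form are invariant under k. *)
Lemma fourier_adj (f : sl2 F -> R[i]) (k : SL2 F) (Y : sl2 F) :
  test_function f -> SL2int F k ->
  fourier psi mug f (adj k Y) = cintegral mug setT (fun X => f (adj k X) * psi (killing X Y)).
Proof.
move=> tf Kk; rewrite /fourier.
rewrite -(mug_change hmug (phi := adj k)).
- by apply: eq_cintegral => X _; rewrite killing_adj.
- exact: adj_continuous.
- exact: adjD.
- by move=> X; exists (adj k^-1%g X); rewrite adjVK.
- by move=> r X; exact: sl2_ball_adj.
apply: ccontinuousM; first exact/ccontinuous_lc/test_locally_constant.
by apply: psi_continuous; apply: killing_continuous;
  [move=> X; exact: cvg_id | exact: cst_continuous].
Qed.

(** After [fourier_adj] this is Fubini's theorem on K times a ball containing the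
    support of f, which K preserves. *)
Lemma Kaverage_fourier (f : sl2 F -> R[i]) (Y : sl2 F) : test_function f ->
  Kaverage muK (fourier psi mug f) Y = fourier psi mug (Kaverage muK f) Y.
Proof.
move=> tf; have [M fM] := test_bounded tf; have [_ [r rP]] := tf.
have lf := test_locally_constant tf.
have b1 : cbounded (fun k : SL2 F => (\1_(SL2int F) k)%:C : R[i]) 1.
  by move=> k; rewrite /= indicE normr0 ger0_norm ?ler01 ?lern1 ?leq_b1 ?ler0n.
rewrite /Kaverage (eq_cintegral _ (fun k Kk => fourier_adj Y tf Kk)).
pose h (z : SL2 F * sl2 F) := (\1_(SL2int F) z.1)%:C * f (adj z.1 z.2) * psi (killing z.2 Y).
have cadj : continuous (fun z : SL2 F * sl2 F => adj z.1 z.2).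
  by apply: continuous_adj => z; [exact: cvg_fst | exact: cvg_snd].
have ch : ccontinuous h.
  apply: ccontinuousM; last first.
    by apply: psi_continuous; apply: killing_continuous;
      [move=> z; exact: cvg_snd | exact: cst_continuous].
  apply: ccontinuousM; last exact: (ccontinuous_comp (ccontinuous_lc lf) cadj).
  by apply: (ccontinuous_comp SL2int_indic_continuous) => z; exact: cvg_fst.
have psi1 : cbounded (fun z : SL2 F * sl2 F => psi (killing z.2 Y)) 1.
  by apply: cbounded_norm1 => z; case: hpsi.
have hb := cboundedM (cboundedM (fun z => b1 z.1) (fun z => fM (adj z.1 z.2))) psi1.
rewrite cintegral_mkcond.
transitivity (cintegral muK setT (fun k => cintegral mug setT (fun X => h (k, X)))).
  apply: eq_cintegral => k _; rewrite /h /=; have [Kk|Kk] := pselect (SL2int F k).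
    by rewrite indicE mem_set// mul1r; apply: eq_cintegral => X _; rewrite mul1r.
  rewrite indicE memNset// mul0r -[LHS](cintegral0 mug setT).
  by apply: eq_cintegral => X _; rewrite !mul0r.
rewrite (cintegral_swap measurable_SL2int (measurable_sl2_ball r) _ (mug_ball_fin hmug r)
  (ccontinuous_measurable2 second_countable_SL2 second_countable_sl2 ch) hb); last 2 first.
- by rewrite hmuK1 ltry.
- move=> k X nKX; rewrite /h/=; have [Kk|Kk] := pselect (SL2int F k); last first.
    by rewrite indicE memNset// !mul0r.
  rewrite [f _](_ : _ = 0) ?mulr0 ?mul0r//; apply: contra_notP nKX => fX; split=> //.
  exact/(sl2_ball_adj r X Kk)/rP.
rewrite /fourier; apply: eq_cintegral => X _; rewrite [in RHS]cintegral_mkcond.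
rewrite -(cintegralZr (D := SL2int F : set (borel (SL2 F))) (M := 1 * M + 1 * M)) //.
- exact: measurable_SL2int.
- by rewrite hmuK1 ltry.
- apply: ccontinuous_measurable; apply: ccontinuousM; first exact: SL2int_indic_continuous.
  apply: (ccontinuous_comp (ccontinuous_lc lf)).
  by apply: continuous_adj; [move=> k; exact: cvg_id | exact: cst_continuous].
- by apply: cboundedM => // k; exact: fM.
- by move=> k Kk; rewrite indicE memNset// mul0r.
Qed.

(** The normalization of the measure, applied to f composed with [rotate]: both
    phases are psi (8 n h) after the change of variables. *)
Lemma fourier_nilpotent (f : sl2 F -> R[i]) : fourier_normalized mu psi mug ->
  test_function f ->
  cintegral mu setT (fun n => fourier psi mug f (sl2_mx 0 (2 * n) 0)) =
  cintegral mu setT (fun b => cintegral mu setT (fun c => f (sl2_mx b c 0))).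
Proof.
move=> nrm tf; have tf' := test_comp rotateB sl2_ball_rotate tf.
have := nrm _ (test_locally_constant tf') (test_compactly_supported tf').
rewrite [X in _ = X -> _](_ : _ = cintegral mu setT
  (fun b => cintegral mu setT (fun c => f (sl2_mx b c 0)))); last first.
  by apply: eq_cintegral => b _; apply: eq_cintegral => c _; rewrite /rotate /= !mxE.
move=> <-; apply: eq_cintegral => n _; rewrite /fourier.
rewrite -(mug_change hmug (phi := rotate)).
- apply: eq_cintegral => X _; congr (_ * psi _).
  by rewrite !killingE /rotate /= !mxE /=; ring.
- exact: rotate_continuous.
- exact: rotateD.
- move=> X; exists (sl2_mx (X 1 0) (X 0 0) (X 0 1)).
  by rewrite [RHS]sl2_eta /rotate /= !mxE.
- by move=> r X; exact: sl2_ball_rotate.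
apply: ccontinuousM; first exact/ccontinuous_lc/test_locally_constant.
by apply: psi_continuous; apply: killing_continuous;
  [move=> X; exact: cvg_id | exact: cst_continuous].
Qed.

Lemma fourier_side (f : sl2 F -> R[i]) : fourier_normalized mu psi mug ->
  test_function f ->
  cintegral mu setT (fun n : F => Kaverage muK (fourier psi mug f) (sl2_mx 0 (2 * n) 0)) =
  cintegral mu setT (fun b => cintegral mu setT (fun c => Kaverage muK f (sl2_mx b c 0))).
Proof.
move=> nrm tf; rewrite -fourier_nilpotent//; last exact: test_Kaverage.
by apply: eq_cintegral => n _; rewrite Kaverage_fourier.
Qed.

End FourierSide.

(** * A section of the torus cosets *)

Section CosetSection.
Context {R : realType} {F : padicFieldType R}.
Local Notation pabs := (@pabs R F).
Hypothesis abs2 : pabs 2 = 1.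

Lemma two_neq0 : (2 : F) != 0.
Proof. by apply/eqP => e; move: abs2; rewrite e pabs0 => /eqP; rewrite eq_sym oner_eq0. Qed.

Lemma pabs_half (x : F) : pabs (x / 2) = pabs x.
Proof. by rewrite pabsM pabsV abs2 invr1 mulr1. Qed.

Fact upper_det (x : F) : \det (mx2 1 (x - 2^-1) 1 (x + 2^-1)) == 1.
Proof. by rewrite det_mx2 !mxE /=; apply/eqP; field; exact: two_neq0. Qed.

(** With k0 = [upper 0] in K, whose columns are eigenvectors of every matrix of
    t_1, this is k0 times the unipotent matrix [[1, x], [0, 1]]. *)
Definition upper (x : F) : SL2 F := mkSL2 (upper_det x).

Lemma adj_upper (x b : F) : adj (upper x) (sl2_mx 0 b b) = sl2_mx b (2 * b * x) 0.
Proof.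
apply: val_inj; rewrite /= (SL2_invE (upper x)) /= !mx2M.
by congr mx2; rewrite !mxE /=; field; try exact: two_neq0.
Qed.

Lemma upper_continuous : continuous upper.
Proof.
apply/continuous_SL2P/mxcontinuous_mx2; try exact: cst_continuous.
  by apply: pcontinuousD; [move=> x; exact: cvg_id | exact: cst_continuous].
by apply: pcontinuousD; [move=> x; exact: cvg_id | exact: cst_continuous].
Qed.

(** [row0 g] and [row1 g] form the lower row of k0^-1 g. *)
Definition row0 (g : SL2 F) : F := g 1 0 - g 0 0.
Definition row1 (g : SL2 F) : F := g 1 1 - g 0 1.

(** This is k0 N K: by the Iwasawa decomposition, k0^-1 g lies in N K exactly when
    its lower row has norm one. *)
Definition section : set (SL2 F) :=
  [set g | [/\ pabs (row0 g) <= 1, pabs (row1 g) <= 1 &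
    pabs (row0 g) = 1 \/ pabs (row1 g) = 1]].

(** The determinant of k0^-1 g. *)
Lemma row_det (g : SL2 F) :
  (g 0 0 + g 1 0) / 2 * row1 g - (g 0 1 + g 1 1) / 2 * row0 g = 1.
Proof.
rewrite -[RHS](SL2_det g) det_mx2 /row0 /row1.
by field; exact: two_neq0.
Qed.

Lemma upperV_mul (x : F) (g : SL2 F) : ((upper x)^-1 * g)%g =
  mx2 ((g 0 0 + g 1 0) / 2 - x * row0 g) ((g 0 1 + g 1 1) / 2 - x * row1 g)
      (row0 g) (row1 g) :> 'M[F]_2.
Proof.
rewrite /= (SL2_invE (upper x)) [X in _ * X]mx2_eta !mx2M /row0 /row1.
by congr mx2; rewrite !mxE /=; field; try exact: two_neq0.
Qed.

(** A unit in the lower row serves to clear the entry above it, and the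
    determinant makes the remaining entry of the upper row a unit. *)
Lemma section_fiber (g : SL2 F) : section g ->
  exists y, forall x, SL2int F ((upper x)^-1 * g)%g <-> pball 1 (- y + x).
Proof.
have KE x : SL2int F ((upper x)^-1 * g)%g <->
    [/\ pabs ((g 0 0 + g 1 0) / 2 - x * row0 g) <= 1,
        pabs ((g 0 1 + g 1 1) / 2 - x * row1 g) <= 1,
        pabs (row0 g) <= 1 & pabs (row1 g) <= 1].
  rewrite /SL2int /pint upperV_mul; split=> [K|[a b c d]].
    by split; [have := K 0 0 | have := K 0 1 | have := K 1 0 | have := K 1 1]; rewrite mxE.
  by apply: forall_mx2; rewrite mxE.
move=> [r01 r11 r].
have dt := row_det g.
set A := (g 0 0 + g 1 0) / 2 in KE dt *; set B := (g 0 1 + g 1 1) / 2 in KE dt *.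
set p := row0 g in KE dt r01 r11 r *; set q := row1 g in KE dt r01 r11 r *.
case: r => [p1|q1].
  have p0 : p != 0 by apply: contra_eq_neq p1 => ->; rewrite pabs0 eq_sym oner_eq0.
  (* The value of x for which the entry above p vanishes. *)
  exists (A / p) => x; split=> [/KE[Ax _ _ _]|xy].
    suff : pabs (p * (- (A / p) + x)) <= 1 by rewrite pabsM p1 mul1r.
    rewrite -pabsN.
    by have -> : - (p * (- (A / p) + x)) = A - x * p by field.
  apply/KE; split=> //.
    have -> : A - x * p = - (p * (- (A / p) + x)) by field.
    by rewrite pabsN pabsM p1 mul1r.
  have -> : B - x * q = - p^-1 - q * (- (A / p) + x).
    by rewrite (_ : - p^-1 = - ((A * q - B * p) / p)); [field | rewrite dt mul1r].
  apply: pabsB_le; first by rewrite pabsN pabsV p1 invr1.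
  by rewrite pabsM mulr_ile1 ?pabs_ge0.
have q0 : q != 0 by apply: contra_eq_neq q1 => ->; rewrite pabs0 eq_sym oner_eq0.
exists (B / q) => x; split=> [/KE[_ Bx _ _]|xy].
  suff : pabs (q * (- (B / q) + x)) <= 1 by rewrite pabsM q1 mul1r.
  rewrite -pabsN.
  by have -> : - (q * (- (B / q) + x)) = B - x * q by field.
apply/KE; split=> //; last first.
  have -> : B - x * q = - (q * (- (B / q) + x)) by field.
  by rewrite pabsN pabsM q1 mul1r.
have -> : A - x * p = q^-1 - p * (- (B / q) + x).
  by rewrite [X in _ = X - _](_ : _ = (A * q - B * p) / q); [field | rewrite dt mul1r].
apply: pabsB_le; first by rewrite pabsV q1 invr1.
by rewrite pabsM mulr_ile1 ?pabs_ge0.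
Qed.

Lemma upper_int_section (x : F) (g : SL2 F) :
  SL2int F ((upper x)^-1 * g)%g -> section g.
Proof.
move=> K; have := SL2_det ((upper x)^-1 * g)%g; rewrite det_mx2.
have := K 0 0; have := K 0 1; have := K 1 0; have := K 1 1.
rewrite upperV_mul !mxE /pint /= => q1 p1 B1 A1 dt; split=> //.
have [/eqP->|pn] := boolP (pabs (row0 g) == 1); first by left.
have [/eqP->|qn] := boolP (pabs (row1 g) == 1); first by right.
have small (a s : F) : pabs a <= 1 -> pabs s < 1 -> pabs (a * s) < 1.
  by move=> a1 s1; rewrite pabsM (le_lt_trans _ s1)// ler_piMl// pabs_ge0.
have : pabs (1 : F) < 1.
  by rewrite -dt; apply: pabsB_lt; apply: small => //; rewrite lt_neqAle ?pn ?qn.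
by rewrite pabs1 ltxx.
Qed.

Lemma near_rows (g : SL2 F) : \forall h \near g,
  pabs (row0 g - row0 h) < 1 /\ pabs (row1 g - row1 h) < 1.
Proof.
have c0 : continuous row0.
  by apply: pcontinuousD; last apply: pcontinuousN;
    exact: (coord_continuous coordinates_SL2 (i := (_, _))).
have c1 : continuous row1.
  by apply: pcontinuousD; last apply: pcontinuousN;
    exact: (coord_continuous coordinates_SL2 (i := (_, _))).
by apply: filterI; [exact: (iffLR (pcontinuousP _) c0) | exact: (iffLR (pcontinuousP _) c1)].
Qed.

Lemma section_close (g h : SL2 F) : pabs (row0 g - row0 h) < 1 ->
  pabs (row1 g - row1 h) < 1 -> section g -> section h.
Proof.
move=> g0 g1 [p1 q1 pq]; split.
- by rewrite -[row0 h](subKr (row0 g)); apply: pabsB_le => //; exact: ltW.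
- by rewrite -[row1 h](subKr (row1 g)); apply: pabsB_le => //; exact: ltW.
case: pq => [p|q]; [left; rewrite -p | right; rewrite -q]; apply: pabs_eq_close.
  by rewrite p.
by rewrite q.
Qed.

Lemma section_lc : locally_constant (fun g : SL2 F => (\1_section g)%:C : R[i]).
Proof.
move=> g; apply: filterS (near_rows g) => h [g0 g1]; congr (_%:C).
rewrite !indicE; congr (nat_of_bool _)%:R; apply/idP/idP; rewrite !inE.
  by apply: section_close; rewrite pabs_distC.
exact: section_close.
Qed.

Lemma measurable_section : measurable (section : set (borel (SL2 F))).
Proof.
apply: borel_open; rewrite openE => g Sg; apply: filterS (near_rows g) => h [g0 g1].
exact: section_close Sg.
Qed.

Section Fiber.
Variable mu : {measure set (borel F) -> \bar R}.
Hypothesis hmu : is_haar (fun x y : F => x + y) setT mu.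
Hypothesis hmu1 : mu (pint F) = 1%E.

(** The fibre is a translate of the ring of integers or empty. *)
Lemma mu_section_fiber (g : SL2 F) :
  mu [set x | SL2int F ((upper x)^-1 * g)%g] = (\1_section g)%:E.
Proof.
have [Sg|Sg] := pselect (section g).
  have [y yP] := section_fiber Sg.
  have -> : [set x | SL2int F ((upper x)^-1 * g)%g] = [set x | pint F (- y + x)].
    by apply/seteqP; split=> x /yP.
  rewrite indicE mem_set//; case: hmu => _ inv _.
  by rewrite (inv (- y) (pint F))//; exact: measurable_pball.
rewrite indicE memNset// [X in mu X](_ : _ = set0) ?measure0//.
by rewrite -subset0 => x /= /upper_int_section.
Qed.
End Fiber.

End CosetSection.

(** * The torus acting on the section *)

Section Torus.
Context {R : realType} {F : padicFieldType R}.
Local Notation pabs := (@pabs R F).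
Hypothesis abs2 : pabs 2 = 1.

(** The row (-1, 1) is a left eigenvector of the torus, of eigenvalue a - b. *)
Lemma row0_torus (a g : SL2 F) : torus1 F a ->
  row0 (a * g)%g = (a 0 0 - a 0 1) * row0 g.
Proof.
move=> [s [t [_ aE]]]; rewrite /row0 /= aE [SL2_val g]mx2_eta mx2M !mxE /=; ring.
Qed.

Lemma row1_torus (a g : SL2 F) : torus1 F a ->
  row1 (a * g)%g = (a 0 0 - a 0 1) * row1 g.
Proof.
move=> [s [t [_ aE]]]; rewrite /row1 /= aE [SL2_val g]mx2_eta mx2M !mxE /=; ring.
Qed.

(** The eigenvalues a - b and a + b are inverse to each other, and 2 is a unit. *)
Lemma torus_int (a : SL2 F) : torus1 F a ->
  SL2int F a <-> pabs (a 0 0 - a 0 1) = 1.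
Proof.
move=> [s [t [st aE]]]; rewrite /SL2int /pint aE !mxE /=.
have prod : pabs (s - t) * pabs (s + t) = 1.
  by rewrite -pabsM -subr_sqr st pabs1.
split=> [K|d1].
  have s1 : pabs s <= 1 by have := K 0 0; rewrite mxE.
  have t1 : pabs t <= 1 by have := K 0 1; rewrite mxE.
  apply/eqP; rewrite eq_le pabsB_le//= -prod ler_piMr ?pabs_ge0//.
  exact: pabsD_le.
have e1 : pabs (s + t) = 1 by rewrite -prod d1 mul1r.
have s1 : pabs s <= 1.
  rewrite -(pabs_half abs2 s) (_ : s / 2 = ((s - t) / 2 + (s + t) / 2) / 2).
    by rewrite pabs_half// pabsD_le// pabs_half// ?d1 ?e1.
  by field; exact: two_neq0.
have t1 : pabs t <= 1.
  by rewrite -[t](subKr s); apply: pabsB_le; rewrite ?d1.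
by apply: forall_mx2; rewrite mxE.
Qed.

(** The torus element with eigenvalues z and z^-1. *)
Fact torus_elt_det (z : F) : z != 0 ->
  \det (mx2 ((z + z^-1) / 2) ((z^-1 - z) / 2) ((z^-1 - z) / 2) ((z + z^-1) / 2)) == 1.
Proof.
by move=> z0; rewrite det_mx2 !mxE /=; apply/eqP; field; rewrite z0 two_neq0.
Qed.

Lemma torus_elt (z : F) : z != 0 -> exists2 c : SL2 F, torus1 F c & c 0 0 - c 0 1 = z.
Proof.
move=> z0; exists (mkSL2 (torus_elt_det z0)); last first.
  by rewrite !mxE /=; field; rewrite z0 two_neq0.
exists ((z + z^-1) / 2), ((z^-1 - z) / 2); split=> //.
by field; rewrite z0 two_neq0.
Qed.

(** Take for c the torus element whose eigenvalue has the norm of the lower row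
    of k0^-1 g: then a g is in the section exactly when the eigenvalues of c a are
    units. *)
Lemma section_torus (g : SL2 F) : exists2 c : SL2 F, torus1 F c &
  forall a, torus1 F a -> section (a * g)%g <-> SL2int F (c * a)%g.
Proof.
have [z z0 zP] : exists2 z, z != 0 & [/\ pabs (row0 g) <= pabs z,
    pabs (row1 g) <= pabs z & pabs (row0 g) = pabs z \/ pabs (row1 g) = pabs z].
  have [le|/ltW le] := leP (pabs (row0 g)) (pabs (row1 g)).
    exists (row1 g); last by split=> //; right.
    apply/eqP => r1; have := row_det abs2 g; move: le.
    rewrite r1 pabs0 => le; have /eqP := le_anti (introT andP (conj le (pabs_ge0 _))).
    by move=> /eqP/pabs_eq0 ->; rewrite !mulr0 subr0 => /eqP; rewrite eq_sym oner_eq0.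
  exists (row0 g); last by split=> //; left.
  apply/eqP => r0; have := row_det abs2 g; move: le.
  rewrite r0 pabs0 => le; have /eqP := le_anti (introT andP (conj le (pabs_ge0 _))).
  by move=> /eqP/pabs_eq0 ->; rewrite !mulr0 subr0 => /eqP; rewrite eq_sym oner_eq0.
have [c cT cz] := torus_elt z0; exists c => // a aT.
have d_ge0 (x : F) := @pabs_ge0 R F x.
have row : (c * a)%g 0 0 - (c * a)%g 0 1 = z * (a 0 0 - a 0 1).
  case: cT cz => s [t [_ cE]]; case: aT => u [v [_ aE]].
  by rewrite /= cE aE mx2M !mxE /= => <-; ring.
rewrite torus_int ?row; last exact: torus1M.
set d := a 0 0 - a 0 1 in row *.
rewrite /section /= !(row0_torus, row1_torus)// -/d !pabsM.
case: zP => r0 r1 r; split=> [[d0 d1 dr]|zd].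
  apply/eqP; rewrite eq_le mulrC; apply/andP; split; first by case: r => <-.
  by case: dr => <-; exact: ler_wpM2l.
rewrite -zd ![pabs z * _]mulrC; split; try exact: ler_wpM2l.
by case: r => ->; [left|right].
Qed.

End Torus.

(** * The orbital integrals *)

Section OrbitalSide.
Context {R : realType} {F : padicFieldType R}.
Local Notation pabs := (@pabs R F).
Hypothesis abs2 : pabs 2 = 1.
Variables (mu : {measure set (borel F) -> \bar R})
  (muG muK muA : {measure set (borel (SL2 F)) -> \bar R})
  (muQ : {measure set (borel (torus1_quot F)) -> \bar R}).
Hypothesis hmu : is_haar (fun x y : F => x + y) setT mu.
Hypothesis hmu1 : mu (pint F) = 1%E.
Hypothesis hmuG : is_haar (fun x y : SL2 F => (x * y)%g) setT muG.
Hypothesis hmuG1 : muG (SL2int F) = 1%E.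
Hypothesis hmuK : is_haar (fun x y : SL2 F => (x * y)%g) (SL2int F) muK.
Hypothesis hmuK1 : muK (SL2int F) = 1%E.
Hypothesis hmuA : is_haar (fun x y : SL2 F => (x * y)%g) (torus1 F) muA.
Hypothesis hmuA1 : muA (torus1 F `&` SL2int F) = 1%E.
Hypothesis hmuQ : is_quotient_measure muG muA muQ.

Lemma torus1E (g : SL2 F) : torus1 F g <-> g 0 0 - g 1 1 = 0 /\ g 0 1 - g 1 0 = 0.
Proof.
split=> [[s [t [_ gE]]]|[/subr0_eq d /subr0_eq o]].
  by rewrite gE !mxE /= !subrr.
exists (g 0 0), (g 0 1); split; last by rewrite [LHS]mx2_eta -d -o.
by have := SL2_det g; rewrite det_mx2 -d -o !expr2.
Qed.

Lemma SL2_coord_continuous i j : continuous (fun g : SL2 F => g i j).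
Proof. exact: (coord_continuous coordinates_SL2 (i := (i, j))). Qed.

Lemma measurable_torus1 : measurable (torus1 F : set (borel (SL2 F))).
Proof.
have cd i j k l : continuous (fun g : SL2 F => g i j - g k l).
  by apply: pcontinuousD; last apply: pcontinuousN; exact: SL2_coord_continuous.
have -> : torus1 F = (fun g : SL2 F => g 0 0 - g 1 1) @^-1` [set 0] `&`
    (fun g : SL2 F => g 0 1 - g 1 0) @^-1` [set 0].
  by apply/seteqP; split=> g /torus1E.
by apply: measurableI; rewrite -[X in measurable X]setTI;
  apply: (continuous_borel_measurable (cd _ _ _ _) measurableT); exact: measurable_point.
Qed.

Lemma mulg_continuous (h : SL2 F) : continuous (fun g : SL2 F => (h * g)%g).
Proof. by apply: continuousMg; [exact: cst_continuous | move=> g; exact: cvg_id]. Qed.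

Lemma mulgr_continuous (h : SL2 F) : continuous (fun g : SL2 F => (g * h)%g).
Proof. by apply: continuousMg; [move=> g; exact: cvg_id | exact: cst_continuous]. Qed.

Lemma torus_fiber_mass (g : SL2 F) :
  muA (torus1 F `&` [set a | section (a * g)%g]) = 1%E.
Proof.
have [c cT cP] := section_torus abs2 g.
case: hmuA => _ inv _; rewrite -hmuA1 -(inv c (torus1 F `&` SL2int F))//; last first.
  by apply: measurableI; [exact: measurable_torus1 | exact: measurable_SL2int].
congr (muA _); apply/seteqP; split=> a /= [aT] => [/(cP _ aT) ca|ca].
  by split=> //; exact: torus1M.
have aT' : torus1 F a by rewrite -(mulKg c a); apply: torus1M => //; exact: torus1V.
by split=> //; apply/cP.
Qed.

(** The section meets every coset of the torus in a set of mass one, so Weil's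
    formula unfolds an integral over the quotient to the section. *)
Lemma quotient_section (f : sl2 F -> R) (b : F) :
  let phi g := f (adj g (sl2_mx 0 b b)) * \1_section g in
  continuous phi -> compactly_supported phi ->
  \int[muQ]_x f (adj (repr x) (sl2_mx 0 b b)) = \int[muG]_g phi g.
Proof.
move=> phi cphi sphi; rewrite /Rintegral (hmuQ cphi sphi); congr fine.
apply: eq_integral => x _; set g := repr x.
have adjT a : torus1 F a -> adj (a * g)%g (sl2_mx 0 b b) = adj g (sl2_mx 0 b b).
  move=> [s [t [st aE]]]; rewrite adjM; congr adj; apply: val_inj => /=.
  apply: (mulrI (SL2_unit a)); rewrite !mulrA mulrV ?SL2_unit// mul1r aE !mx2M.
  by congr mx2; ring.
have mS : measurable ([set a | section (a * g)%g] : set (borel (SL2 F))).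
  rewrite -[X in measurable X]setTI.
  exact: (continuous_borel_measurable (@mulgr_continuous g) measurableT measurable_section).
pose S : set (borel (SL2 F)) := [set a | section (a * g)%g].
rewrite (eq_integral (cst (f (adj g (sl2_mx 0 b b)))%:E \_ S)); last first.
  move=> a; rewrite inE => aT; rewrite /phi adjT// patchE indicE.
  rewrite (_ : ((a * g)%g \in section) = (a \in S)); last by apply/idP/idP; rewrite !inE.
  by case: ifP; rewrite ?mulr1 ?mulr0.
rewrite -integral_mkcondr integral_cst; last by apply: measurableI => //; exact: measurable_torus1.
by rewrite torus_fiber_mass mule1.
Qed.

(** If g = upper x k, the matrix g^-1 X_b g is conjugate under K to
    [[b, 2 b x], [0, -b]], so the support of f bounds x, and then g. *)
Lemma orbit_support (f : sl2 F -> R[i]) (r : R) (b x : F) (g : SL2 F) :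
  (forall X, f X <> 0 -> sl2_ball r X) -> b != 0 ->
  SL2int F ((upper abs2 x)^-1 * g)%g -> f (adj g (sl2_mx 0 b b)) <> 0 ->
  pball (r / pabs b) x /\ SL2_ball (Num.max 1 (r / pabs b)) g.
Proof.
move=> rP b0; set k := (_ * g)%g => Kk fg.
have gE : g = (upper abs2 x * k)%g by rewrite mulVKg.
have xr : pabs x <= r / pabs b.
  move: fg; rewrite gE adjM adj_upper => /rP/(sl2_ball_adj r _ Kk)/sl2_ballP[_].
  by rewrite !mxE /= !pabsM abs2 mul1r mulrC ler_pdivlMr ?pabs_gt0// mulrC.
split=> // i j; rewrite gE -[leRHS]mulr1; apply: mulmx_bound; last exact: Kk.
have half1 : pabs 2^-1 = 1 by rewrite pabsV abs2 invr1.
apply: forall_mx2; rewrite mxE /= le_max ?pabs1 ?lexx// -le_max.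
  by apply: pabsB_le; rewrite le_max ?half1 ?lexx// xr orbT.
by apply: pabsD_le; rewrite le_max ?half1 ?lexx// xr orbT.
Qed.

(** Uniqueness of the invariant probability measure on K. *)
Lemma integral_SL2int (f : SL2 F -> R[i]) :
  cintegral muG (SL2int F) f = cintegral muK (SL2int F) f.
Proof.
have E A : measurable (A : set (borel (SL2 F))) -> A `<=` SL2int F -> muG A = muK A.
  move=> mA AK; rewrite -[RHS]mul1e.
  case: (hmuG) => _ invG _; case: (hmuK) => _ invK _.
  apply: (@haar_unique R (SL2 F) (fun x y => (x * y)%g) (fun x => x^-1%g)
    _ _ _ _ _ _ (SL2int F)) => //.
  - exact: second_countable_SL2.
  - by move=> x y; rewrite mulKg.
  - by move=> x y; rewrite mulVKg.
  - by move=> x y; rewrite invgM invgK.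
  - by apply: continuousVg => y; exact: cvg_id.
  - by apply: continuousMg; [apply: continuousVg => z; exact: cvg_fst | move=> z; exact: cvg_snd].
  - by rewrite SL2intE; exact: open_SL2_ball.
  - by move=> x y; exact: SL2intM.
  - by move=> x; exact: SL2intV.
  - by move=> h B _ mB; exact: invG.
  - by rewrite hmuK1 ltry.
  by rewrite hmuK1 hmuG1 mule1.
apply: complex_eq; congr fine; apply: eq_measure_integral => A mA AK; exact: E.
Qed.

Lemma left_translate (f : SL2 F -> R[i]) (h : SL2 F) : ccontinuous f ->
  cintegral muG setT (fun g => f (h * g)%g) = cintegral muG setT f.
Proof.
move=> /ccontinuous_measurable[fr fi]; case: hmuG => _ inv _.
have ch (q : borel (SL2 F) -> R) : measurable_fun setT q ->
    \int[muG]_g q (h * g)%g = \int[muG]_g q g.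
  move=> mq; rewrite -[RHS]mul1r.
  apply: (@Rintegral_change _ _ _ muG (fun g => (h * g)%g)) => //.
    exact: (continuous_borel_measurable (@mulg_continuous h)).
  by move=> A mA; rewrite mul1e; exact: inv.
by apply: complex_eq; [exact: ch fr | exact: ch fi].
Qed.

(** The indicator of the section is the integral over x of the indicator of
    [upper x] K; after exchanging the integrals, g is replaced by [upper x] g. *)
Lemma orbital_integral (f : sl2 F -> R[i]) (b : F) : test_function f -> b != 0 ->
  cintegral muQ setT (fun x : torus1_quot F => f (adj (repr x) (sl2_mx 0 b b))) =
  cintegral mu setT (fun x => Kaverage muK f (sl2_mx b (2 * b * x) 0)).
Proof.
move=> tf b0; have [M fM] := test_bounded tf; have [_ [r rP]] := tf.
have lf := test_locally_constant tf.
pose f' g := f (adj g (sl2_mx 0 b b)).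
have cf' : ccontinuous f'.
  apply: (ccontinuous_comp (ccontinuous_lc lf)).
  by apply: continuous_adj; [move=> g; exact: cvg_id | exact: cst_continuous].
pose C := Num.max 1 (r / pabs b).
have S0 g : section g -> f' g <> 0 -> SL2_ball C g.
  move=> /(section_fiber abs2)[y yP] fg.
  have Ky : SL2int F ((upper abs2 y)^-1 * g)%g.
    by apply/yP; rewrite /pball/= addNr pabs0.
  exact: (orbit_support rP b0 Ky fg).2.
have cS (q : SL2 F -> R) : (forall g, section g -> q g <> 0 -> SL2_ball C g) ->
    compactly_supported (fun g => q g * \1_section g).
  move=> qC; apply: (subclosed_compact _ (@compact_SL2_ball R F C)).
    exact: closed_closure.
  rewrite closureE; apply: smallest_sub; first exact: closed_SL2_ball.
  move=> g /=; have [Sg|Sg] := pselect (section g).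
    by rewrite indicE mem_set// mulr1 => /eqP; exact: qC.
  by rewrite indicE memNset// mulr0 eqxx.
have [cSr _] := ccontinuous_lc (@section_lc R F).
have [cfr cfi] := cf'.
transitivity (cintegral muG setT (fun g => f' g * (\1_section g)%:C)).
  apply: complex_eq.
    rewrite /= (quotient_section (f := fun X => complex.Re (f X))).
    - by apply: eq_Rintegral => g _; rewrite [in RHS]mulrC complexReZ mulrC.
    - by move=> g; exact: (cvgM (cfr g) (cSr g)).
    - by apply: cS => g Sg fg; apply: S0 => // fg0; apply: fg; rewrite -/(f' g) fg0.
  rewrite /= (quotient_section (f := fun X => complex.Im (f X))).
  - by apply: eq_Rintegral => g _; rewrite [in RHS]mulrC complexImZ mulrC.
  - by move=> g; exact: (cvgM (cfi g) (cSr g)).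
  - by apply: cS => g Sg fg; apply: S0 => // fg0; apply: fg; rewrite -/(f' g) fg0.
pose h (z : SL2 F * F) := f' z.1 * (\1_(SL2int F) ((upper abs2 z.2)^-1 * z.1)%g)%:C.
have cu : continuous (fun z : SL2 F * F => ((upper abs2 z.2)^-1 * z.1)%g).
  apply: continuousMg; last by move=> z; exact: cvg_fst.
  apply: continuousVg => z; apply: (@continuous_comp _ _ _ snd (upper abs2)).
    exact: cvg_snd.
  exact: upper_continuous.
have ch : ccontinuous h.
  apply: ccontinuousM.
    by apply: (ccontinuous_comp cf') => z; exact: cvg_fst.
  exact: (ccontinuous_comp (@SL2int_indic_continuous R F) cu).
have b1 : cbounded (fun k : SL2 F => (\1_(SL2int F) k)%:C : R[i]) 1.
  by move=> k; rewrite /= indicE normr0 ger0_norm ?ler01 ?lern1 ?leq_b1 ?ler0n.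
have hb : cbounded h (M * 1 + M * 1).
  apply: cboundedM => z; first exact: fM.
  exact: b1.
transitivity (cintegral muG setT (fun g => cintegral mu setT (fun x => h (g, x)))).
  apply: eq_cintegral => g _.
  pose D : set (borel F) := [set x | SL2int F ((upper abs2 x)^-1 * g)%g].
  have cD : continuous (fun x => ((upper abs2 x)^-1 * g)%g).
    apply: continuousMg; last exact: cst_continuous.
    by apply: continuousVg; exact: upper_continuous.
  have mD : measurable D.
    rewrite -[D]setTI.
    exact: (continuous_borel_measurable cD measurableT (@measurable_SL2int R F)).
  have muD : mu D = (\1_section g)%:E := mu_section_fiber abs2 hmu hmu1 g.
  have -> : (\1_section g)%:C = cintegral mu setT (fun x => (\1_D x)%:C).
    apply: complex_eq; rewrite /=; first by rewrite Rintegral_indic// muD.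
    by rewrite /Rintegral integral0.
  rewrite mulrC -(cintegralZr (f' g) mD (M := 1)) ?muD ?ltry//.
  - by apply: eq_cintegral => x _; rewrite /h /= mulrC.
  - by apply: ccontinuous_measurable; exact: (ccontinuous_comp (@SL2int_indic_continuous R F) cD).
  - by move=> x; exact: (b1 ((upper abs2 x)^-1 * g)%g).
  - by move=> x Dx; rewrite indicE memNset.
have hS g x : ~ (SL2_ball C g /\ pball (r / pabs b) x) -> h (g, x) = 0.
  move=> nS; rewrite /h/=.
  have [Kg|Kg] := pselect (SL2int F ((upper abs2 x)^-1 * g)%g); last first.
    by rewrite indicE memNset// mulr0.
  rewrite [f' g](_ : _ = 0) ?mul0r//; apply: contra_notP nS => fg.
  by have [] := orbit_support rP b0 Kg fg.
have mSL2 : measurable (SL2_ball C : set (borel (SL2 F))).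
  by apply: borel_closed; exact: closed_SL2_ball.
have muGfin : (muG (SL2_ball C) < +oo)%E.
  by case: hmuG => _ _; apply; exact: compact_SL2_ball.
rewrite (cintegral_swap mSL2 (@measurable_pball R F _) muGfin (mu_pball_fin hmu _)
  (ccontinuous_measurable2 (@second_countable_SL2 R F) (@second_countable_padic R F) ch) hb hS).
apply: eq_cintegral => x _; rewrite /Kaverage -integral_SL2int [RHS]cintegral_mkcond.
rewrite -(@left_translate _ (upper abs2 x)); last first.
  apply: (ccontinuous_comp (g := fun g : SL2 F => (g, x)) ch) => g.
  exact: (cvg_pair (G := nbhs g) (H := nbhs x) cvg_id (cvg_cst x)).
by apply: eq_cintegral => g _; rewrite /h /f' /= mulKg adjM adj_upper mulrC.
Qed.

(** The substitution x |-> 2 b x has Jacobian |2 b| = |b|. *)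
Lemma orbital_integral_scaled (f : sl2 F -> R[i]) (b : F) : test_function f -> b != 0 ->
  (pabs b)%:C *
  cintegral muQ setT (fun x : torus1_quot F => f (adj (repr x) (sl2_mx 0 b b))) =
  cintegral mu setT (fun x => Kaverage muK f (sl2_mx b x 0)).
Proof.
move=> tf b0; rewrite orbital_integral//.
have tk := test_Kaverage muK tf.
have pb : 0 < pabs b := pabs_gt0 b0.
have cK : ccontinuous (fun x : F => Kaverage muK f (sl2_mx b x 0)).
  apply: (ccontinuous_comp (ccontinuous_lc (test_locally_constant tk))).
  by apply: continuous_sl2_mx; try exact: cst_continuous; move=> x; exact: cvg_id.
have [mr mi] := ccontinuous_measurable cK.
have ch (q : borel F -> R) : measurable_fun setT q ->
    pabs b * \int[mu]_x q (2 * b * x) = \int[mu]_x q x.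
  move=> mq; rewrite (@Rintegral_change _ _ _ mu (fun x => 2 * b * x) (pabs b)^-1)//.
  - by rewrite mulrA divff ?mul1r// gt_eqF.
  - by rewrite invr_ge0 ltW.
  - apply: continuous_borel_measurable; apply: pcontinuousM; first exact: cst_continuous.
    by move=> x; exact: cvg_id.
  - move=> A mA; rewrite (mu_scale hmu hmu1)//; last by rewrite mulf_neq0// (two_neq0 abs2).
    by rewrite pabsM abs2 mul1r.
by apply: complex_eq; rewrite ?complexReZ ?complexImZ; [exact: ch mr | exact: ch mi].
Qed.

(** The integrands agree for b <> 0, and a point has mass zero. At b = 0 the left
    one vanishes because of the factor |b|. *)
Lemma orbital_side (f : sl2 F -> R[i]) : test_function f ->
  cintegral mu setT (fun b : F => (pabs b)%:C *
    cintegral muQ setT (fun x : torus1_quot F => f (adj (repr x) (sl2_mx 0 b b)))) =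
  cintegral mu setT (fun b => cintegral mu setT (fun c => Kaverage muK f (sl2_mx b c 0))).
Proof.
move=> tf; have [[e e0 eP] _] := test_Kaverage muK tf.
pose J (b : F) := cintegral mu setT (fun c => Kaverage muK f (sl2_mx b c 0)).
have lJ : locally_constant J.
  move=> b; have : \forall b' \near b, pabs (b - b') < e.
    by apply/coordinates_padic; exists e => // b' /(_ tt).
  apply: filterS => b' bb'; apply: eq_cintegral => c _; apply: eP.
  apply/sl2_ballP; rewrite !mxE /= !subrr pabs0 (ltW e0) pabs_distC.
  by split=> //; exact: ltW.
have [mr mi] := ccontinuous_measurable (ccontinuous_lc lJ).
have ae (q q' : borel F -> R) : measurable_fun setT q -> q' 0 = 0 ->
    (forall b, b != 0 -> q' b = q b) -> \int[mu]_b q' b = \int[mu]_b q b.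
  move=> mq q'0 qq'; congr fine.
  have m0 := @measurable_point R F 0.
  have q'E : q' = (fun b => q b * \1_(~` [set 0]) b).
    apply/funext => b; rewrite indicE; have [->|b0] := eqVneq b 0.
      by rewrite q'0 memNset ?mulr0//; apply.
    by rewrite qq'// mem_set ?mulr1// => /eqP; rewrite (negPf b0).
  apply: ae_eq_integral => //; try exact/measurable_EFinP.
    apply/measurable_EFinP; rewrite q'E; apply: measurable_funM => //.
    by apply: measurable_indic; exact: measurableC.
  exists [set 0]; split => //; first exact: mu_point0.
  move=> b /= nb; apply: contrapT => /eqP b0; apply: nb => _.
  by rewrite qq'.
apply: complex_eq; apply: ae => //.
- by rewrite complexReZ pabs0 mul0r.
- by move=> b b0; rewrite orbital_integral_scaled.
- by rewrite complexImZ pabs0 mul0r.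
- by move=> b b0; rewrite orbital_integral_scaled.
Qed.

End OrbitalSide.

Theorem mainTheorem3 (R : realType) (F : padicFieldType R)
  (p : nat) (hp : residue_char F p) (hp2 : (2 < p)%N)
  (mu : {measure set (borel F) -> \bar R})
  (hmu : is_haar (fun x y : F => x + y) setT mu) (hmu1 : mu (pint F) = 1%E)
  (psi : F -> R[i])
  (hpsi : additive_character psi) (hpsi1 : exists x, psi x != 1)
  (mug : {measure set (borel (sl2 F)) -> \bar R})
  (hmug : is_haar (fun X Y : sl2 F => X + Y) setT mug) (hmugN : fourier_normalized mu psi mug)
  (muG : {measure set (borel (SL2 F)) -> \bar R})
  (hmuG : is_haar (fun x y : SL2 F => (x * y)%g) setT muG)
  (hmuG1 : muG (SL2int F) = 1%E)
  (muK : {measure set (borel (SL2 F)) -> \bar R})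
  (hmuK : is_haar (fun x y : SL2 F => (x * y)%g) (SL2int F) muK)
  (hmuK1 : muK (SL2int F) = 1%E)
  (muA : {measure set (borel (SL2 F)) -> \bar R})
  (hmuA : is_haar (fun x y : SL2 F => (x * y)%g) (torus1 F) muA)
  (hmuA1 : muA (torus1 F `&` SL2int F) = 1%E)
  (muQ : {measure set (borel (torus1_quot F)) -> \bar R})
  (hmuQ : is_quotient_measure muG muA muQ)
  (f : sl2 F -> R[i])
  (hf : locally_constant f) (hfc : compactly_supported f) :
  cintegral mu setT (fun b : F =>
    (pabs b)%:C *
    cintegral muQ setT (fun x : torus1_quot F =>
      f (adj (repr x) (sl2_mx 0 b b))))
  = cintegral mu setT (fun n : F =>
      Kaverage muK (fourier psi mug f) (sl2_mx 0 (2%:R * n) 0)).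
Proof.
have abs2 := pabs2_eq1 hp hp2.
have tf := test_functionP hf hfc.
rewrite (orbital_side abs2 hmu hmu1 hmuG hmuG1 hmuK hmuK1 hmuA hmuA1 hmuQ tf).
by rewrite (fourier_side hpsi hmug hmuK1 hmugN tf).
Qed.
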